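(* Let $f:\mathbb{R}\to\mathbb{R}$ be real analytic, let $\mathcal{M}_f=(\mathbb{R}^4,g_f)$, where, in coordinates $(x,y,\tilde x,\tilde y)$, the non-zero components (up to symmetry) of $g_f$ are $g_f(\partial_x,\partial_x)=-2f(y)$ and $g_f(\partial_x,\partial_{\tilde x})=g_f(\partial_y,\partial_{\tilde y})=1$, and let $\mathfrak{g}_f$ be the Lie algebra of the isometry group of $\mathcal{M}_f$. Then: (1) If $f^{(2)}\equiv0$, then $\dim\mathfrak{g}_f=10$. (2) If $f^{(2)}\equiv c$ for a constant $c\ne0$, then $\dim\mathfrak{g}_f=8$. (3) If $f^{(2)}=ae^{\lambda y}$ for some real $a\ne0$ and $\lambda\ne0$, then $\dim\mathfrak{g}_f=6$. (4) If $f^{(2)}=a(y+b)^n$ for some real $a\ne0$, some $b\in\mathbb{R}$ and some $n\in\{1,2,\dots\}$, then $\dim\mathfrak{g}_f=6$. (5) If $f^{(2)}$ is not of the form $ae^{\lambda y}$ for any $a,\lambda\in\mathbb{R}$ and is not of the form $a(y+b)^n$ for any $a,b\in\mathbb{R}$ and $n\in\mathbb{N}$, then $\dim\mathfrak{g}_f=5$.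
   Context: $f^{(j)}$ denotes the $j$-th derivative of $f$. The Lie algebra $\mathfrak{g}_f$ is identified with the Lie algebra of all Killing vector fields on $\mathcal{M}_f$. *)

(* Defs.v *)
From HB Require Import structures.
From mathcomp Require Import all_boot all_order all_algebra.
From mathcomp Require Import all_classical all_reals all_analysis.
Set Implicit Arguments.
Unset Strict Implicit.
Unset Printing Implicit Defensive.
Import Order.TTheory GRing.Theory Num.Theory.
Import numFieldNormedType.Exports.
Local Open Scope classical_set_scope.
Local Open Scope ring_scope.

Definition real_analytic (R : realType) (f : R -> R) : Prop :=
  forall x0 : R, exists (a : nat -> R) (r : R), 0 < r /\
    forall x : R, `|x - x0| < r -> pseries a (x - x0) @ \oo --> f x.

Definition partial (R : realType) (n : nat) (i : 'I_n.+1)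
    (h : 'rV[R]_n.+1 -> R) : 'rV[R]_n.+1 -> R :=
  fun p => 'D_(delta_mx 0 i) h p.

Definition iter_partial (R : realType) (n : nat) (s : seq 'I_n.+1)
    (h : 'rV[R]_n.+1 -> R) : 'rV[R]_n.+1 -> R :=
  foldr (@partial R n) h s.

(* ['D_v] is total, with an unspecified value where the limit does not exist,
   so existence of every iterated partial derivative is required separately. *)
Definition smooth (R : realType) (n : nat) (h : 'rV[R]_n.+1 -> R) : Prop :=
  forall s : seq 'I_n.+1, continuous (iter_partial s h) /\
    forall (i : 'I_n.+1) (p : 'rV[R]_n.+1),
      derivable (iter_partial s h) p (delta_mx 0 i).

Definition smooth_vector_field (R : realType) (n : nat)
    (X : 'rV[R]_n.+1 -> 'rV[R]_n.+1) : Prop :=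
  forall i : 'I_n.+1, smooth (fun p => X p 0 i).

(* (L_X g)_ij =
     X^k (d_k g_ij) + g_kj (d_i X^k) + g_ik (d_j X^k), summed over k *)
Definition lie_derivative (R : realType) (n : nat)
    (X : 'rV[R]_n.+1 -> 'rV[R]_n.+1) (g : 'rV[R]_n.+1 -> 'M[R]_n.+1) :
    'rV[R]_n.+1 -> 'M[R]_n.+1 :=
  fun p => \matrix_(i, j) \sum_k
    (X p 0 k * partial k (fun q => g q i j) p
     + g p k j * partial i (fun q => X q 0 k) p
     + g p i k * partial j (fun q => X q 0 k) p).

Definition killing_fields (R : realType) (n : nat)
    (g : 'rV[R]_n.+1 -> 'M[R]_n.+1) : set ('rV[R]_n.+1 -> 'rV[R]_n.+1) :=
  [set X | smooth_vector_field X /\ forall p, lie_derivative X g p = 0].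

(* [K] is a linear subspace of [V] with a basis of [d] elements. *)
Definition has_dim (R : realType) (V : lmodType R) (K : set V) (d : nat) : Prop :=
  exists e : 'I_d -> V,
    (forall c : 'I_d -> R, \sum_i c i *: e i = 0 -> forall i, c i = 0) /\
    K = [set v | exists c : 'I_d -> R, v = \sum_i c i *: e i].

(* The coordinates (x, y, x~, y~) have indices 0, 1, 2, 3. *)
Definition metric (R : realType) (f : R -> R) : 'rV[R]_4 -> 'M[R]_4 :=
  fun p => \matrix_(i, j)
    match val i, val j with
    | 0%N, 0%N => - 2 * f (p 0 1)
    | 0%N, 2%N | 2%N, 0%N | 1%N, 3%N | 3%N, 1%N => 1
    | _, _ => 0
    end.

(* The Lie algebra of the isometry group, identified with the space of Killing
   vector fields. *)
Definition isometry_algebra (R : realType) (f : R -> R) :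
    set ('rV[R]_4 -> 'rV[R]_4) :=
  killing_fields (metric f).

(* Main.v *)
(* The Killing equations are ten first-order linear equations for X = (A, B, C, D) in the
   coordinates (x, y, u, v) = (x, y, x~, y~). The six of them free of f force A, B and D
   to be polynomial on the fibres of x: A = y al(x) + be(x) + v bv(x), B = ga(x) - u bv(x)
   + y ep(x), D = de(x) - u al(x) - v ep(x). Integrating the remaining four for C makes
   al and bv constant, ep, ga and be' affine, and determines C and D from a primitive F of
   f, up to ten real parameters, among them b = bv, e = ep(0), p = ga', q = ga(0) and
   s = be'(0). The only conditions left on the parameters are
     b f'' = 0,  p f''' = 0,  f'''(y) (e y + q) + 2 (e + s) f''(y) = 0,
   so every Killing algebra is a subspace of R^10. The last condition is an Euler equation
   (y + q/e) g' = m g for g = f'' if e <> 0, whose smooth solutions on the whole line are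
   the a (y + q/e)^n: for k > m the derivative h = g^(k) satisfies (y + q/e) h' = - w h
   with w > 0, so that h^2 decreases away from its zero -q/e and h vanishes. If e = 0 and
   q <> 0, then g is an exponential. *)
Require Import Defs.
From HB Require Import structures.
From mathcomp Require Import all_boot all_order all_algebra.
From mathcomp Require Import all_classical all_reals all_analysis.
From mathcomp Require Import ring lra.
Import Order.TTheory GRing.Theory Num.Theory.
Import numFieldNormedType.Exports.
Local Open Scope ring_scope.
Local Open Scope classical_set_scope.
Set Implicit Arguments.
Unset Strict Implicit.
Unset Printing Implicit Defensive.

(** * Real analytic functions are smooth *)

(** Comparison with a geometric series: for [|x| * (1 + h) < t < r], convergence at [t] bounds
    [|c n| * t ^ n], and [n + 1 <= (1 + h) ^ n / h], so the terms are of order [q ^ n] with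
    [q = |x| * (1 + h) / t < 1]. *)
Lemma is_cvg_pseries_diffs (R : realType) (c : R^nat) (r x : R) :
  (forall z, `|z| < r -> cvgn (pseries c z)) -> `|x| < r ->
  cvgn (pseries (pseries_diffs c) x).
Proof.
move=> cvg_c xr.
(* The second bound keeps [|x| * (1 + h)] below [r]; the cap at 1 gives the base case of the
   Bernoulli estimate. *)
pose h : R := Num.min 1 ((r - `|x|) / 2 / (`|x| + 1)).
have x0 : 0 <= `|x| by [].
have h0 : 0 < h by rewrite lt_min ltr01/= !divr_gt0// ?subr_gt0// ltr_wpDl.
have h1 : h <= 1 by rewrite ge_min lexx.
pose s := `|x| * (1 + h) + (r - `|x|) / 4.
have s_r : s < r.
  have : `|x| * h <= (r - `|x|) / 2.
    have : h <= (r - `|x|) / 2 / (`|x| + 1) by rewrite ge_min lexx orbT.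
    by rewrite ler_pdivlMr ?ltr_wpDl// mulrDr mulr1 mulrC =>
      /(le_trans _); apply; rewrite lerDl ltW.
  rewrite /s; lra.
have xs : `|x| * (1 + h) < s by rewrite /s; lra.
pose t : R := (`|x| * (1 + h) + s) / 2.
have xt : `|x| * (1 + h) < t by rewrite /t; lra.
have ts : t < s by rewrite /t; lra.
have xh0 : 0 <= `|x| * (1 + h) by rewrite mulr_ge0// addr_ge0// ltW.
have t0 : 0 < t by lra.
clearbody t h.
have /cvg_series_bounded[K [Kreal Kf]] : cvgn (pseries c t).
  by apply: cvg_c; rewrite gtr0_norm//; lra.
have K1 n : `|c n * t ^+ n| <= `|K + 1|.
  by apply: Kf => //; rewrite (lt_le_trans _ (ler_norm _))// ltrDl.
apply: normed_cvg.
pose q := `|x| * (1 + h) / t.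
have q0 : 0 <= q by rewrite divr_ge0// ltW.
apply: (@series_le_cvg _ _ (fun n => `|K + 1| / h / t * q ^+ n)) => [n|n|n|] /=.
- by [].
- by rewrite !mulr_ge0// ?exprn_ge0// invr_ge0 ltW.
- rewrite /pseries_diffs !normrM normrX (ger0_norm (ler0n _ _)).
  (* Bernoulli's inequality, using [h <= 1] *)
  have bern : n.+1%:R <= (1 + h) ^+ n / h.
    rewrite ler_pdivlMr//; elim: n => [|n IH]; first by rewrite expr0 mul1r.
    rewrite exprSr mulrDr mulr1 [_ * h]mulrC -[in leLHS]natr1 mulrDl mul1r.
    rewrite lerD// ler_peMr ?(ltW h0)//.
    by rewrite exprn_ege1// lerDl ltW.
  have cn : `|c n.+1| <= `|K + 1| / t ^+ n.+1.
    rewrite ler_pdivlMr ?exprn_gt0//.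
    by rewrite -(ger0_norm (exprn_ge0 n.+1 (ltW t0))) -normrM.
  have := ler_pM (ler0n _ _) (normr_ge0 _) bern cn.
  move=> /(ler_wpM2r (exprn_ge0 n x0)) /le_trans; apply.
  rewrite le_eqVlt; apply/orP; left; apply/eqP.
  rewrite /q !exprMn exprVn exprSr.
  have tn : t ^+ n != 0 by rewrite expf_neq0 ?gt_eqF.
  have tn0 : t != 0 by rewrite ?gt_eqF.
  have hn0 : h != 0 by rewrite ?gt_eqF.
  by field; rewrite tn tn0 hn0.
- apply: is_cvg_geometric_series.
  by rewrite ger0_norm// ltr_pdivrMr// mul1r.
Qed.

(** Termwise differentiation keeps the radius at every centre, so analyticity passes to the
    derivative and smoothness follows by induction. *)
Lemma real_analytic_is_derive (R : realType) (f : R -> R) : real_analytic f ->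
  (forall x, derivable f x 1) /\ real_analytic f^`().
Proof.
move=> fan.
suff loc x0 : exists (a : nat -> R) (r : R), 0 < r /\
    forall x, `|x - x0| < r -> derivable f x 1 /\
      pseries a (x - x0) @ \oo --> f^`() x.
  split=> [x|x0].
    have [a [r [r0]]] := loc x.
    by case/(_ x); rewrite ?subrr ?normr0.
  have [a [r [r0 H]]] := loc x0.
  by exists a, r; split => // x /H[].
have [a [r [r0 fa]]] := fan x0.
exists (pseries_diffs a), r; split => // x xr.
have ca z : `|z| < r -> cvgn (pseries a z).
  by move=> zr; have := fa (z + x0); rewrite addrK => /(_ zr) /cvgP.
have cda z : `|z| < r -> cvgn (pseries (pseries_diffs a) z).
  exact: is_cvg_pseries_diffs.
have cdda z : `|z| < r -> cvgn (pseries (pseries_diffs (pseries_diffs a)) z).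
  exact: is_cvg_pseries_diffs.
(* [pseries_snd_diffs] asks for convergence of the series and of its first two formal derivatives at
   a point farther out than [x - x0]. *)
pose K := (`|x - x0| + r) / 2.
have x0K : `|x - x0| < K by rewrite /K; lra.
have K0 : 0 < K by apply: le_lt_trans x0K.
have Kr : `|K| < r by rewrite gtr0_norm// /K; lra.
have dp : is_derive (x - x0) (1 : R) (fun z => limn (pseries a z))
    (limn (pseries (pseries_diffs a) (x - x0))).
  by apply: (@pseries_snd_diffs R a K); [exact: ca|exact: cda|exact: cdda|rewrite (gtr0_norm K0)].
have df : is_derive x (1 : R) f (limn (pseries (pseries_diffs a) (x - x0))).
  have dsh : is_derive x (1 : R) (fun z => z - x0) 1 by exact: is_derive_shift.
  have := @is_derive1_comp R _ (fun z => z - x0) x _ _ dp dsh; rewrite mulr1.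
  (* [f] is known to be the sum of the series only inside the disc, which contains a neighbourhood
     of [x]. *)
  apply: near_eq_is_derive.
  near=> z.
  have zr : `|z - x0| < r.
    near: z.
    exists (r - `|x - x0|); first by rewrite /= subr_gt0.
    move=> z /= xz.
    have : `|z - x0| <= `|x - z| + `|x - x0|.
      rewrite (distrC x z) (le_trans _ (ler_normD _ _))//.
      by rewrite addrA subrK.
    by move=> ?; lra.
  rewrite /=; apply/cvg_lim => //; exact: fa.
split; first by case: df.
rewrite derive1E (@derive_val _ _ _ _ _ _ _ df).
exact: cda.
Unshelve. all: by end_near.
Qed.

Definition smooth1 (R : realType) (f : R -> R) : Prop :=
  forall k x, derivable (f^`(k)) x 1.

Lemma derive1nSE (R : realType) (f : R -> R) k : f^`(k.+1) = (f^`())^`(k).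
Proof. by rewrite /derive1n iterSr. Qed.

Lemma smooth1_derive (R : realType) (f : R -> R) : smooth1 f -> smooth1 f^`().
Proof. by move=> fs k x; rewrite -derive1nSE; exact: fs. Qed.

Lemma smooth1_is_derive (R : realType) (f : R -> R) x :
  smooth1 f -> is_derive x (1 : R) f (f^`() x).
Proof. by move=> fs; rewrite derive1E; apply/derivableP; exact: (fs 0%N). Qed.

Lemma real_analytic_smooth1 (R : realType) (f : R -> R) :
  real_analytic f -> smooth1 f.
Proof.
move=> fan k; elim: k f fan => [|k IH] f fan x.
  by have [+ _] := real_analytic_is_derive fan; apply.
by rewrite derive1nSE; apply: IH; have [] := real_analytic_is_derive fan.
Qed.

(** * One-variable calculus *)

Lemma is_derive_eq_fun (R : realType) (f g : R -> R) (x d : R) :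
  f =1 g -> is_derive x (1 : R) f d -> is_derive x (1 : R) g d.
Proof. by move=> /funext ->. Qed.

Lemma is_derive_unique (R : realType) (f : R -> R) (x d e : R) :
  is_derive x (1 : R) f d -> is_derive x (1 : R) f e -> d = e.
Proof. by move=> [_ <-] [_ <-]. Qed.

(* Eta-expanded forms of library lemmas: they unify with lambda terms syntactically,
   without class inference. *)
Lemma is_derive_fun_cst (R : realType) (c x : R) : is_derive x (1 : R) (fun=> c) 0.
Proof. exact: is_derive_cst. Qed.

Lemma is_derive_fun_id (R : realType) (x : R) : is_derive x (1 : R) (fun y : R => y) 1.
Proof. exact: is_derive_id. Qed.

Lemma is_derive_fun_add (R : realType) (f g : R -> R) (x d e : R) :
  is_derive x (1 : R) f d -> is_derive x (1 : R) g e ->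
  is_derive x (1 : R) (fun y => f y + g y) (d + e).
Proof. by move=> df dg; exact: is_deriveD. Qed.

Lemma is_derive_fun_opp (R : realType) (f : R -> R) (x d : R) :
  is_derive x (1 : R) f d -> is_derive x (1 : R) (fun y => - f y) (- d).
Proof. by move=> df; exact: is_deriveN. Qed.

Lemma is_derive_fun_mul (R : realType) (f g : R -> R) (x d e : R) :
  is_derive x (1 : R) f d -> is_derive x (1 : R) g e ->
  is_derive x (1 : R) (fun y => f y * g y) (d * g x + f x * e).
Proof.
move=> df dg; have := @is_deriveM _ _ f g x 1 d e df dg.
by rewrite addrC [f x *: e]/GRing.scale/= [g x *: d]mulrC.
Qed.

Lemma is_derive_fun_exp (R : realType) (f : R -> R) (n : nat) (x d : R) :
  is_derive x (1 : R) f d ->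
  is_derive x (1 : R) (fun y => f y ^+ n) (n%:R * f x ^+ n.-1 * d).
Proof.
move=> df; have := @is_deriveX _ _ f n x 1 d df.
by rewrite exprfctE.
Qed.

(** The mean value theorem on an open interval; this local form serves to glue primitives along an
    overlap. *)
Lemma is_derive0_cst_oo (R : realType) (g : R -> R) (a b x y : R) :
  (forall z, a < z < b -> is_derive z (1 : R) g 0) ->
  a < x < b -> a < y < b -> g x = g y.
Proof.
move=> dg; wlog xy : x y / x <= y.
  move=> H xab yab; case: (leP x y) => [/H|/ltW/H E]; first exact.
  by rewrite E.
move=> /andP[ax xb] /andP[ay yb].
have sub z : x <= z <= y -> is_derive z (1 : R) g 0.
  by move=> /andP[xz zy]; apply: dg; rewrite (lt_le_trans ax)//= (le_lt_trans zy).
have dgo z : z \in `]x, y[%R -> is_derive z (1 : R) g 0.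
  by rewrite in_itv/= => /andP[/ltW xz /ltW zy]; apply: sub; rewrite xz.
have cg : {within `[x, y], continuous g}.
  by apply: derivable_within_continuous => z; rewrite in_itv/= => /sub [].
have [c _] := @MVT_segment R g (fun=> 0) x y xy dgo cg.
by rewrite mul0r => /eqP; rewrite subr_eq0 => /eqP.
Qed.

Lemma primitive_right (R : realType) (f : R -> R) (a : R) : continuous f ->
  exists P : R -> R, forall x, a < x -> is_derive x (1 : R) P (f x).
Proof.
move=> cf.
exists (fun x => (\int[lebesgue_measure]_(t in [set` `[a, x]]) (f t))%R) => x ax.
have xu : x < x + 1 by rewrite ltrDl.
have intf : lebesgue_measure.-integrable `[a, x + 1] (EFin \o f).
  apply: continuous_compact_integrable; first exact: segment_compact.
  exact: continuous_subspaceT.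
have [d dE] := continuous_FTC1_closed xu intf ax (cf x).
by rewrite -dE derive1E; exact/derivableP.
Qed.

(** The integral gives primitives only to the right of a base point, so two are glued: [P] on []-1,
    +oo[], and on []-oo, 1[] the reflection of a primitive [Q] of [f (- x)]. They differ by a
    constant on the overlap, and both are normalised to vanish at 0. *)
Lemma continuous_primitive (R : realType) (f : R -> R) : continuous f ->
  exists F : R -> R, F 0 = 0 /\ forall x, is_derive x (1 : R) F (f x).
Proof.
move=> cf.
have [P dP] := primitive_right (-1) cf.
have cg : continuous (fun x => f (- x)).
  by move=> x; apply: continuous_comp; [exact: opp_continuous|exact: cf].
have [Q dQ] := primitive_right (-1) cg.
have dQN (x : R) : x < 1 -> is_derive x (1 : R) (fun z => - Q (- z)) (f x).
  move=> x1; have xN : -1 < - x by rewrite ltrN2.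
  have dN : is_derive x (1 : R) (fun y : R => - y) (- 1).
    exact: is_derive_fun_opp (is_derive_fun_id _).
  have := is_derive_fun_opp (@is_derive1_comp R Q (fun y => - y) x _ _ (dQ _ xN) dN).
  by rewrite mulrN1 opprK opprK.
have PQ (x : R) : -1 < x < 1 -> Q 0 - Q (- x) = P x - P 0.
  move=> x1.
  have : P 0 - - Q (- 0) = P x - - Q (- x).
    apply: (@is_derive0_cst_oo R (fun z => P z - - Q (- z)) (-1) 1) => //.
      move=> z /andP[z1 z2]; rewrite -(subrr (f z)).
      by apply: is_derive_fun_add; [exact: dP|exact/is_derive_fun_opp/dQN].
    by rewrite ltrN10 ltr01.
  by rewrite oppr0; lra.
(* The switch at -1/2 is interior to the overlap []-1, 1[], so near every point a single formula is
   valid. *)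
exists (fun x => if -(1 / 2) < x then P x - P 0 else Q 0 - Q (- x)); split.
  by rewrite ifT ?subrr//; lra.
move=> x; have [x0|x0] := ltP (- (1 / 2)) x.
  apply: (@near_eq_is_derive _ _ _ (fun x => P x - P 0)).
    near=> z; rewrite ifT//; near: z; exact: lt_nbhsr.
  have Px : is_derive x (1 : R) P (f x) by apply: dP; lra.
  by have := is_derive_fun_add Px (is_derive_fun_cst (- P 0) x); rewrite addr0.
have x1 : x < 1 by lra.
apply: (@near_eq_is_derive _ _ _ (fun x => Q 0 - Q (- x))).
  near=> z; case: ifPn => // z1; rewrite PQ//; apply/andP; split; first by lra.
  near: z; exact: lt_nbhsl.
by have := is_derive_fun_add (is_derive_fun_cst (Q 0) x) (dQN x x1); rewrite add0r.
Unshelve. all: by end_near.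
Qed.

(** The slope is written as [h 1 - h 0] to match the way [compatible] expresses affinity. *)
Lemma affine_of_derive2 (R : realType) (h h' : R -> R) :
  (forall x, is_derive x (1 : R) h (h' x)) ->
  (forall x, is_derive x (1 : R) h' 0) ->
  forall x, h x = h 0 + x * (h 1 - h 0).
Proof.
move=> dh dh'.
have h'c (x : R) : h' x = h' 0 by exact: is_derive_0_is_cst.
have aff x : h x = h 0 + x * h' 0.
  have : h x - x * h' 0 = h 0 - 0 * h' 0.
    apply: (@is_derive_0_is_cst _ (fun x => h x - x * h' 0)) => z.
    have := is_derive_fun_add (dh z) (is_derive_fun_opp
      (is_derive_fun_mul (is_derive_fun_id z) (is_derive_fun_cst (h' 0) z))).
    by rewrite h'c mul1r mulr0 addr0 subrr.
  by rewrite mul0r subr0 => /eqP; rewrite subr_eq => /eqP.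
by move=> x; rewrite aff (aff 1) mul1r addrAC subrr add0r.
Qed.

(** A nonzero solution would behave like [(x + b) ^ (- w)], which is singular at [- b];
    differentiability on the whole line excludes it. *)
Lemma eq0_of_euler_neg (R : realType) (h h' : R -> R) (b w : R) :
  (forall x, is_derive x (1 : R) h (h' x)) -> 0 < w ->
  (forall x, (x + b) * h' x = - w * h x) -> forall x, h x = 0.
Proof.
move=> dh w0 eq.
have hb : h (- b) = 0.
  by have := eq (- b); rewrite addNr mul0r => /esym/eqP;
    rewrite mulf_eq0 oppr_eq0 gt_eqF//= => /eqP.
have dh2 x : is_derive x (1 : R) (fun y => h y * h y) (h' x * h x + h x * h' x).
  by apply: is_derive_fun_mul.
(* [h ^ 2] is nonincreasing away from [- b], where it vanishes *)
have sq_le x : h x * h x <= h (- b) * h (- b).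
  have sgn z : (z + b) * (h' z * h z + h z * h' z) <= 0.
    have -> : (z + b) * (h' z * h z + h z * h' z) = 2 * h z * ((z + b) * h' z) by ring.
    rewrite eq; have := sqr_ge0 (h z); nra.
  have cont A : {within A, continuous (fun y => h y * h y)}.
    apply: continuous_subspaceT => z.
    by apply/differentiable_continuous/derivable1_diffP; case: (dh2 z).
  have [xb|xb] := leP (- b) x.
    apply: (@ler0_derive1_le_cc _ (fun y => h y * h y) (- b) x) => //.
    - move=> z; rewrite in_itv/= => /andP[bz zx].
      rewrite derive1E (@derive_val _ _ _ _ _ _ _ (dh2 z)).
      by have := sgn z; rewrite pmulr_rle0//; lra.
    - by rewrite in_itv/= lexx ?andbT.
    - by rewrite in_itv/= lexx ?andbT.
  have xb' := ltW xb.
  apply: (@ger0_derive1_le_cc _ (fun y => h y * h y) x (- b)) => //.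
  - move=> z; rewrite in_itv/= => /andP[bz zx].
    rewrite derive1E (@derive_val _ _ _ _ _ _ _ (dh2 z)).
    by have := sgn z; rewrite nmulr_rle0//; lra.
  - by rewrite in_itv/= lexx ?andbT.
  - by rewrite in_itv/= lexx ?andbT.
move=> x; have := sq_le x; rewrite hb mulr0 -expr2 => h0.
by apply/eqP; rewrite -sqrf_eq0 eq_le h0 sqr_ge0.
Qed.

(** Each derivative lowers the exponent by one, so iteration reaches the negative exponents of
    [eq0_of_euler_neg]. *)
Lemma euler_derive (R : realType) (g : R -> R) (b m : R) : smooth1 g ->
  (forall x, (x + b) * derive1 g x = m * g x) ->
  forall x, (x + b) * derive1 (derive1 g) x = (m - 1) * derive1 g x.
Proof.
move=> gs eq x.
have dg := smooth1_is_derive x gs.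
have dg' := smooth1_is_derive x (smooth1_derive gs).
have d1 : is_derive x (1 : R) (fun x => (x + b) * derive1 g x)
    ((1 + 0) * derive1 g x + (x + b) * derive1 (derive1 g) x).
  exact: is_derive_fun_mul (is_derive_fun_add (is_derive_fun_id x) (is_derive_fun_cst b x)) dg'.
have d2 : is_derive x (1 : R) (fun x => (x + b) * derive1 g x)
    (0 * g x + m * derive1 g x).
  apply: (is_derive_eq_fun (f := fun x => m * g x)) => [y|]; first by rewrite eq.
  exact: is_derive_fun_mul (is_derive_fun_cst m x) dg.
by have := is_derive_unique d1 d2; lra.
Qed.

(** Some derivative of [g] vanishes because its Euler exponent is negative. The power is then
    recovered by induction on the order of that derivative. *)
Lemma euler_power (R : realType) (g : R -> R) (b m : R) : smooth1 g ->
  (forall x, (x + b) * derive1 g x = m * g x) ->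
  exists (a : R) (n : nat), forall x, g x = a * (x + b) ^+ n.
Proof.
move=> gs eq.
have [k gk] : exists k, forall x, derive1n k g x = 0.
  suff eqk k : smooth1 (derive1n k g) /\
      forall x, (x + b) * derive1 (derive1n k g) x = (m - k%:R) * derive1n k g x.
    (* This [k] exceeds [m], so the [k]-th derivative has exponent [m - k < 0]. *)
    pose k := (Num.truncn `|m|).+1.
    exists k; have [gks geq] := eqk k.
    apply: (@eq0_of_euler_neg R (derive1n k g) (derive1 (derive1n k g)) b (k%:R - m)) => [x||x].
    - exact: smooth1_is_derive.
    - rewrite subr_gt0 (le_lt_trans (ler_norm m))//.
      exact: truncnS_gt.
    - by rewrite geq; ring.
  elim: k => [|k [IHs IH]]; first by split=> // x; rewrite subr0.
  split; first exact: smooth1_derive.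
  by move=> x; have := euler_derive IHs IH x; rewrite -natr1 opprD addrA.
elim: k g m gs eq gk => [|k IH] g m gs eq gk.
  by exists 0, 0%N => x; rewrite mul0r; exact: gk.
have [|a [n ga]] := IH _ _ (smooth1_derive gs) (euler_derive gs eq).
  by move=> x; rewrite -derive1nSE.
(* For [m <> 0] the equation gives [g] from its derivative without integrating. For [m = 0], its
   value at [1 - b], where [x + b = 1], gives [a = 0], and [g] is constant. *)
have [m0|m0] := eqVneq m 0; last first.
  by exists (a / m), n.+1 => x; apply: (mulfI m0); rewrite -eq ga exprS; field.
exists (g 0), 0%N => x; rewrite expr0 mulr1.
have a0 : a = 0.
  by have := eq (1 - b); rewrite m0 ga subrK expr1n mulr1 mul1r mul0r.
apply: is_derive_0_is_cst => z.
by have := smooth1_is_derive z gs; rewrite ga a0 mul0r.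
Qed.

(** The integrating factor [expR (- l * x)] makes the product constant. The case [l = 0] covers
    constant functions. *)
Lemma exp_ode (R : realType) (g : R -> R) (l : R) : smooth1 g ->
  (forall x, derive1 g x = l * g x) -> forall x, g x = g 0 * expR (l * x).
Proof.
move=> gs eq x.
have : g x * expR (- l * x) = g 0 * expR (- l * 0).
  apply: (@is_derive_0_is_cst _ (fun x => g x * expR (- l * x))) => z.
  have dl : is_derive z (1 : R) (fun x => - l * x) (0 * z + (- l) * 1).
    exact: is_derive_fun_mul (is_derive_fun_cst (- l) z) (is_derive_fun_id z).
  have de := @is_derive1_comp R expR _ z _ _ (is_derive_expR (- l * z)) dl.
  have := is_derive_fun_mul (smooth1_is_derive z gs) de.
  by rewrite eq (_ : _ + _ = 0)//=; ring.
rewrite mulr0 expR0 mulr1 => <-.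
by rewrite -mulrA -expRD mulNr addNr expR0 mulr1.
Qed.

(** * Smooth functions on coordinate space *)

Definition set_coord (R : realType) (n : nat) (p : 'rV[R]_n.+1) (i : 'I_n.+1) (t : R) :
    'rV[R]_n.+1 :=
  \row_j (if j == i then t else p 0 j).

(** The two difference quotients coincide as functions of the increment, so existence and value of
    the derivative transfer together. All partial derivatives are computed in one variable this
    way. *)
Lemma is_derive_coord (R : realType) (n : nat) (h : 'rV[R]_n.+1 -> R)
    (p : 'rV[R]_n.+1) (i : 'I_n.+1) (d : R) :
  is_derive p (delta_mx 0 i) h d <->
  is_derive (p 0 i) (1 : R) (fun t => h (set_coord p i t)) d.
Proof.
have E : (fun t : R => t^-1 *: ((h \o shift p) (t *: delta_mx 0 i) - h p)) =
   (fun t : R => t^-1 *: (((fun t => h (set_coord p i t)) \o shift (p 0 i)) (t *: 1)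
      - h (set_coord p i (p 0 i)))).
  apply/funext => t /=; congr (_ *: (h _ - h _)); apply/rowP => j.
    rewrite !mxE eqxx /=; have [->|_] := eqVneq j i; last by rewrite mulr0 add0r.
    by [].
  by rewrite /set_coord !mxE; have [->|] := eqVneq j i.
have dE : derivable h p (delta_mx 0 i) =
    derivable (fun t => h (set_coord p i t)) (p 0 i) 1.
  exact: (congr1 (fun D : R -> R => cvg (D @ 0^')) E).
have DE : 'D_(delta_mx 0 i) h p = 'D_1 (fun t => h (set_coord p i t)) (p 0 i).
  exact: (congr1 (fun D : R -> R => lim (D @ 0^')) E).
split=> -[dh hd]; constructor.
- by rewrite -dE.
- by rewrite -DE.
- by rewrite dE.
- by rewrite DE.
Qed.

Lemma is_derive_comp_coord (R : realType) (n : nat) (phi : R -> R)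
    (p : 'rV[R]_n.+1) (i k : 'I_n.+1) (d : R) :
  is_derive (p 0 i) (1 : R) phi d ->
  is_derive p (delta_mx 0 k) (fun q : 'rV[R]_n.+1 => phi (q 0 i)) (d * (k == i)%:R).
Proof.
move=> dphi; apply/is_derive_coord; have [->|ki] := eqVneq k i.
  rewrite mulr1; apply: is_derive_eq_fun dphi => t.
  by rewrite /set_coord mxE eqxx.
rewrite mulr0; apply: is_derive_eq_fun (is_derive_fun_cst (phi (p 0 i)) _) => t.
by rewrite /set_coord mxE eq_sym (negbTE ki).
Qed.

Lemma partial_is_derive (R : realType) (n : nat) (h : 'rV[R]_n.+1 -> R)
    (p : 'rV[R]_n.+1) (i : 'I_n.+1) (d : R) :
  is_derive p (delta_mx 0 i) h d -> partial i h p = d.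
Proof. by move=> dh; rewrite /partial; case: dh. Qed.

Lemma smooth1_of_derive (R : realType) (F f : R -> R) :
  (forall x, is_derive x (1 : R) F (f x)) -> smooth1 f -> smooth1 F.
Proof.
move=> dF fs [|k] x; first by case: (dF x).
suff -> : derive1n k.+1 F = derive1n k f by exact: fs.
rewrite derive1nSE; congr (derive1n k _); apply/funext => y.
by rewrite derive1E; case: (dF y).
Qed.

Lemma smooth1_cst (R : realType) (c : R) : smooth1 (fun=> c).
Proof.
move=> k; elim: k c => [|k IH] c x; first by case: (is_derive_fun_cst c x).
rewrite derive1nSE (_ : derive1 _ = fun=> 0)//; apply/funext => y.
by rewrite derive1E; case: (is_derive_fun_cst c y).
Qed.

Lemma smooth1_id (R : realType) : smooth1 (fun x : R => x).
Proof.
exact: smooth1_of_derive (@is_derive_fun_id R) (@smooth1_cst R 1).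
Qed.

(** A class of continuous functions closed under partial derivatives, so that smoothness, which
    concerns all iterated partials, follows by induction. Its leaves are arbitrary smooth functions
    of one coordinate, to include [f] and its primitive. *)
Inductive elementary (R : realType) (n : nat) : ('rV[R]_n.+1 -> R) -> Prop :=
| elementary_comp i phi : smooth1 phi -> elementary (fun p => phi (p 0 i))
| elementary_add h k : elementary h -> elementary k ->
    elementary (fun p => h p + k p)
| elementary_mul h k : elementary h -> elementary k ->
    elementary (fun p => h p * k p).

Lemma elementary_cst (R : realType) (n : nat) (c : R) :
  elementary (fun _ : 'rV[R]_n.+1 => c).
Proof. exact: (elementary_comp 0 (@smooth1_cst R c)). Qed.

Lemma elementary_coord (R : realType) (n : nat) (i : 'I_n.+1) :
  elementary (fun p : 'rV[R]_n.+1 => p 0 i).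
Proof. exact: (elementary_comp i (@smooth1_id R)). Qed.

Lemma elementary_opp (R : realType) (n : nat) (h : 'rV[R]_n.+1 -> R) :
  elementary h -> elementary (fun p => - h p).
Proof.
move=> eh; rewrite (_ : (fun p => - h p) = (fun p => -1 * h p)).
  by apply: elementary_mul => //; exact: elementary_cst.
by apply/funext => p; rewrite mulN1r.
Qed.

Lemma elementary_partial (R : realType) (n : nat) (h : 'rV[R]_n.+1 -> R) i :
  elementary h -> elementary (partial i h) /\
    forall p, derivable h p (delta_mx 0 i).
Proof.
move=> eh; suff [h' [eh' dh]] : exists h', elementary h' /\
    forall p, is_derive p (delta_mx 0 i) h (h' p).
  split=> [|p]; last by case: (dh p).
  by rewrite (_ : partial i h = h')//; apply/funext => p; exact: partial_is_derive.
elim: eh => {h} [j phi phis|h k _ [h' [eh' dh]] _ [k' [ek' dk]]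
    |h k eh [h' [eh' dh]] ek [k' [ek' dk]]].
- exists (fun p => derive1 phi (p 0 j) * (i == j)%:R); split=> [|p].
    apply: elementary_mul; last exact: elementary_cst.
    exact: (elementary_comp j (smooth1_derive phis)).
  exact/is_derive_comp_coord/smooth1_is_derive.
- exists (fun p => h' p + k' p); split=> [|p]; first exact: elementary_add.
  exact: is_deriveD.
- exists (fun p => h p * k' p + k p * h' p); split=> [|p].
    by apply: elementary_add; exact: elementary_mul.
  exact: is_deriveM.
Qed.

Lemma elementary_continuous (R : realType) (n : nat) (h : 'rV[R]_n.+1 -> R) :
  elementary h -> continuous h.
Proof.
elim=> {h} [j phi phis p|h k _ ch _ ck p|h k _ ch _ ck p].
- apply: (@continuous_comp _ _ _ (fun p : 'rV[R]_n.+1 => p 0 j) phi).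
    exact: coord_continuous.
  exact/differentiable_continuous/derivable1_diffP/(phis 0%N).
- exact: cvgD (ch p) (ck p).
- exact: cvgM (ch p) (ck p).
Qed.

Lemma elementary_smooth (R : realType) (n : nat) (h : 'rV[R]_n.+1 -> R) :
  elementary h -> smooth h.
Proof.
move=> eh s; have es : elementary (iter_partial s h).
  by elim: s => //= i s IH; have [] := elementary_partial i IH.
split; first exact: elementary_continuous.
by move=> i p; have [] := elementary_partial i es.
Qed.

Lemma smooth_derivable (R : realType) (n : nat) (h : 'rV[R]_n.+1 -> R) i p :
  smooth h -> is_derive p (delta_mx 0 i) h (partial i h p).
Proof. by move=> /(_ [::])[_ dh]; apply/derivableP; exact: dh. Qed.

(** * The Killing equations *)

Definition ix : 'I_4 := @Ordinal 4 0 isT.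
Definition iy : 'I_4 := @Ordinal 4 1 isT.
Definition iu : 'I_4 := @Ordinal 4 2 isT.
Definition iv : 'I_4 := @Ordinal 4 3 isT.

Lemma forall_I4 (P : 'I_4 -> Prop) : P ix -> P iy -> P iu -> P iv -> forall k, P k.
Proof.
move=> Px Py Pu Pv [[|[|[|[|//]]]] k4].
- by rewrite (_ : Ordinal k4 = ix)//; exact: val_inj.
- by rewrite (_ : Ordinal k4 = iy)//; exact: val_inj.
- by rewrite (_ : Ordinal k4 = iu)//; exact: val_inj.
- by rewrite (_ : Ordinal k4 = iv)//; exact: val_inj.
Qed.

Lemma sum_I4 (V : nmodType) (F : 'I_4 -> V) :
  \sum_k F k = F ix + F iy + F iu + F iv.
Proof.
rewrite !big_ord_recl big_ord0 addr0 !addrA.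
by congr (F _ + F _ + F _ + F _); exact: val_inj.
Qed.

Definition mk4 (T : Type) (x y u v : T) : 'rV[T]_4 :=
  \row_i match val i with 0%N => x | 1%N => y | 2%N => u | _ => v end.

Lemma mk4E (R : realType) (p : 'rV[R]_4) :
  p = mk4 (p 0 ix) (p 0 iy) (p 0 iu) (p 0 iv).
Proof. by apply/rowP; apply: forall_I4; rewrite mxE. Qed.

(* [D k i] stands for the derivative of the [i]-th component in the [k]-th
   direction, [B] for the [y]-component, [f0] and [f1] for the values of the
   profile function and of its derivative. *)
Record killing_eqs (R : realType) (f0 f1 B : R) (D : 'I_4 -> 'I_4 -> R) : Prop :=
  KillingEqs {
    killing_xx : D ix iu = f1 * B + 2 * f0 * D ix ix;
    killing_xy : D ix iv + D iy iu = 2 * f0 * D iy ix;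
    killing_xu : D ix ix + D iu iu = 2 * f0 * D iu ix;
    killing_xv : D ix iy + D iv iu = 2 * f0 * D iv ix;
    killing_yy : D iy iv = 0;
    killing_yu : D iy ix + D iu iv = 0;
    killing_yv : D iy iy + D iv iv = 0;
    killing_uu : D iu ix = 0;
    killing_uv : D iv ix + D iu iy = 0;
    killing_vv : D iv iy = 0 }.

Lemma partial_cst (R : realType) (n : nat) (c : R) k (p : 'rV[R]_n.+1) :
  partial k (fun=> c) p = 0.
Proof. by apply: partial_is_derive; exact: is_derive_cst. Qed.

(** Only the [xx] entry of the metric varies, and only along [y]: of the terms [X^k d_k g_ij] a
    single one survives. *)
Lemma partial_metric (R : realType) (f : R -> R) (p : 'rV[R]_4) (f1 : R)
    (k i j : 'I_4) : is_derive (p 0 iy) (1 : R) f f1 ->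
  partial k (fun q => metric f q i j) p =
  (if (val i == 0%N) && (val j == 0%N) then - 2 * f1 * (k == iy)%:R else 0).
Proof.
move=> df; case: ifPn => ij.
  rewrite (_ : (fun q => _) = (fun q : 'rV[R]_4 => - 2 * f (q 0 iy))).
    have := is_derive_fun_mul (is_derive_fun_cst (- 2) (p 0 iy)) df; rewrite mul0r add0r => df2.
    exact/partial_is_derive/is_derive_comp_coord.
  have one_iy : (1 : 'I_4) = iy by exact: val_inj.
  apply/funext => q; rewrite /metric mxE one_iy.
  by case/andP: ij => /eqP -> /eqP ->.
rewrite (_ : (fun q => _) = (fun=> metric f 0 i j)); first exact: partial_cst.
apply/funext => q; rewrite /metric !mxE.
by case: i j ij => [[|[|[|[|//]]]] ?] [[|[|[|[|//]]]] ?].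
Qed.

(** Abstract [D], [g] and [L] replace partials, metric and Lie derivative, so that [ring] sees plain
    variables. Symmetry reduces sixteen entries to ten, of which the diagonal ones carry a factor
    2. *)
Lemma lie_system (R : realType) (f0 f1 B : R) (D : 'I_4 -> 'I_4 -> R)
    (g : 'I_4 -> 'I_4 -> R) (L : 'I_4 -> 'I_4 -> R) :
  (forall i j, g i j = match val i, val j with
    | 0%N, 0%N => - 2 * f0
    | 0%N, 2%N | 2%N, 0%N | 1%N, 3%N | 3%N, 1%N => 1
    | _, _ => 0
    end) ->
  (forall i j, L i j =
    (if (val i == 0%N) && (val j == 0%N) then - 2 * f1 * B else 0) +
    (\sum_k g k j * D i k + \sum_k g i k * D j k)) ->
  (forall i j, L i j = 0) <-> killing_eqs f0 f1 B D.
Proof.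
move=> gE LE.
have {}LE i j := etrans (LE i j) (congr2 (fun s t => _ + (s + t)) (sum_I4 _) (sum_I4 _)).
have s1 i j : L i j = L j i.
  rewrite !LE andbC; congr (_ + _).
  have gC k l : g k l = g l k.
    by rewrite !gE; case: k l => [[|[|[|[|//]]]] ?] [[|[|[|[|//]]]] ?].
  by rewrite !(gC i) !(gC j) [RHS]addrC.
have xx : L ix ix = 2 * (D ix iu - (f1 * B + 2 * f0 * D ix ix)).
  by rewrite LE !gE /=; ring.
have xy : L ix iy = D ix iv + D iy iu - 2 * f0 * D iy ix.
  by rewrite LE !gE /=; ring.
have xu : L ix iu = D ix ix + D iu iu - 2 * f0 * D iu ix.
  by rewrite LE !gE /=; ring.
have xv : L ix iv = D ix iy + D iv iu - 2 * f0 * D iv ix.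
  by rewrite LE !gE /=; ring.
have yy : L iy iy = 2 * D iy iv by rewrite LE !gE /=; ring.
have yu : L iy iu = D iy ix + D iu iv by rewrite LE !gE /=; ring.
have yv : L iy iv = D iy iy + D iv iv by rewrite LE !gE /=; ring.
have uu : L iu iu = 2 * D iu ix by rewrite LE !gE /=; ring.
have uv : L iu iv = D iv ix + D iu iy by rewrite LE !gE /=; ring.
have vv : L iv iv = 2 * D iv iy by rewrite LE !gE /=; ring.
clear LE gE.
have dbl (c : R) : 2 * c = 0 -> c = 0.
  by move=> /eqP; rewrite mulf_eq0 pnatr_eq0 => /eqP.
split=> [L0|[kxx kxy kxu kxv kyy kyu kyv kuu kuv kvv]].
  split; [apply/eqP; rewrite -subr_eq0; apply/eqP/dbl; rewrite -xx
    |apply/eqP; rewrite -subr_eq0 -xy; apply/eqP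
    |apply/eqP; rewrite -subr_eq0 -xu; apply/eqP
    |apply/eqP; rewrite -subr_eq0 -xv; apply/eqP
    |apply: dbl; rewrite -yy|rewrite -yu|rewrite -yv
    |apply: dbl; rewrite -uu|rewrite -uv|apply: dbl; rewrite -vv]; exact: L0.
by apply: forall_I4; apply: forall_I4; rewrite ?xx ?xy ?xu ?xv ?yy ?yu ?yv ?uu ?uv ?vv
  ?(s1 iy ix) ?(s1 iu ix) ?(s1 iv ix) ?(s1 iu iy) ?(s1 iv iy) ?(s1 iv iu)
  ?xx ?xy ?xu ?xv ?yy ?yu ?yv ?uu ?uv ?vv
  ?kxx ?kxy ?kxu ?kxv ?kyy ?kyu ?kyv ?kuu ?kuv ?kvv ?subrr ?mulr0.
Qed.

Lemma lie_derivative_metric0 (R : realType) (f : R -> R) (X : 'rV[R]_4 -> 'rV[R]_4)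
    (p : 'rV[R]_4) (f1 : R) : is_derive (p 0 iy) (1 : R) f f1 ->
  lie_derivative X (metric f) p = 0 <->
  killing_eqs (f (p 0 iy)) f1 (X p 0 iy) (fun k i => partial k (fun q => X q 0 i) p).
Proof.
move=> df.
have one_iy : (1 : 'I_4) = iy by exact: val_inj.
rewrite -(@lie_system _ _ _ _ _ (metric f p) (lie_derivative X (metric f) p)).
- split=> [-> i j|L]; first by rewrite mxE.
  by apply/matrixP => i j; rewrite L mxE.
- by move=> i j; rewrite /metric mxE one_iy.
- move=> i j; rewrite /lie_derivative mxE -big_split/=.
  under eq_bigr do rewrite -addrA (partial_metric _ _ _ df).
  rewrite big_split/=; congr (_ + _).
  by rewrite sum_I4 /=; case: ifP => _; rewrite !(mulr0, addr0, add0r, mulr1)// mulrC.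
Qed.

(** * A ten-parameter family of Killing fields *)

(** Differentiates by syntax, with hypotheses for unknown functions; [deriv] then leaves the
    equality with the announced value. *)
Ltac derive_fun := lazymatch goal with
  | |- is_derive _ _ (fun _ => ?c) _ => notypeclasses refine (is_derive_fun_cst _ _)
  | |- is_derive _ _ (fun t => t) _ => notypeclasses refine (is_derive_fun_id _)
  | |- is_derive _ _ (fun t => @GRing.add _ (@?g t) (@?h t)) _ =>
      notypeclasses refine (is_derive_fun_add (f := g) (g := h) _ _); derive_fun
  | |- is_derive _ _ (fun t => @GRing.opp _ (@?g t)) _ =>
      notypeclasses refine (is_derive_fun_opp (f := g) _); derive_fun
  | |- is_derive _ _ (fun t => @GRing.mul _ (@?g t) (@?h t)) _ =>
      notypeclasses refine (is_derive_fun_mul (f := g) (g := h) _ _); derive_fun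
  | dg : forall y, is_derive y _ ?g _ |- is_derive _ _ (fun t => ?g t) _ => exact (dg _)
  | dg : forall y, is_derive y _ ?g _ |- is_derive _ _ ?g _ => exact (dg _)
  end.

Ltac deriv := (notypeclasses refine (is_derive_eq _ _); [derive_fun | cbv beta]).

Definition param (R : realType) (n : nat) (th : 'rV[R]_n.+1) (k : nat) : R := th 0 (inord k).

Definition params (R : realType) (n : nat) (l : seq R) : 'rV[R]_n.+1 :=
  \row_(i < n.+1) nth 0 l i.

Lemma param_row (R : realType) (n : nat) (l : seq R) (k : nat) : (k < n.+1)%N ->
  param (params n l) k = nth 0 l k.
Proof. by move=> kn; rewrite /param mxE inordK. Qed.

(* A row [th : 'rV_10] lists the parameters a, b, e, s, t, p, q, d0, d1, c0 of a
   Killing field, with x-component a y + b (v + f'(0) x^2 / 2) + s x + t,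
   y-component (e + b f'(0) x) y + p x + q - b u, and d0, d1, c0 the values at the
   origin of the v-component, its x-derivative and the u-component; [source] is the
   x-derivative of the u-component on the plane u = v = 0, and [shear] that of the
   v-component. *)
Definition source (R : realType) (f : R -> R) (th : 'rV[R]_10) (x y : R) : R :=
  derive1 f y * ((param th 2 + param th 1 * derive1 f 0 * x) * y + param th 5 * x + param th 6)
  + 2 * f y * (param th 3 + param th 1 * derive1 f 0 * x).

Definition shear (R : realType) (f : R -> R) (th : 'rV[R]_10) (x : R) : R :=
  param th 8 + x * (source f th 0 0 - source f th 0 1)
  + x * x / 2 * (source f th 1 0 - source f th 1 1 - (source f th 0 0 - source f th 0 1)).

Definition killing_x (R : realType) (f : R -> R) (th : 'rV[R]_10) (x y u v : R) : R :=
  param th 0 * y + param th 1 * derive1 f 0 * (x * x / 2) + param th 3 * x + param th 4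
  + param th 1 * v.

Definition killing_y (R : realType) (f : R -> R) (th : 'rV[R]_10) (x y u v : R) : R :=
  (param th 2 + param th 1 * derive1 f 0 * x) * y + param th 5 * x + param th 6
  - param th 1 * u.

(** The first three terms integrate [source] along [y = 0], where it is affine in [x]; those in [F]
    and [shear] integrate the [xy] equation; the slopes in [v] and [u] are forced by the [xv] and
    [xu] equations. *)
Definition killing_u (R : realType) (f F : R -> R) (th : 'rV[R]_10) (x y u v : R) : R :=
  param th 9 + x * source f th 0 0 + x * x / 2 * (source f th 1 0 - source f th 0 0)
  + 2 * param th 0 * F y - y * shear f th x
  + v * (2 * f y * param th 1 - param th 5 - y * (param th 1 * derive1 f 0))
  - u * (param th 3 + param th 1 * derive1 f 0 * x).

(** The first four terms are the primitive of [shear] with value d0 at 0. *)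
Definition killing_v (R : realType) (f : R -> R) (th : 'rV[R]_10) (x y u v : R) : R :=
  param th 7 + param th 8 * x + x * x / 2 * (source f th 0 0 - source f th 0 1)
  + x * x * x / 6 * (source f th 1 0 - source f th 1 1 - (source f th 0 0 - source f th 0 1))
  - param th 0 * u - (param th 2 + param th 1 * derive1 f 0 * x) * v.

Definition killing_field (R : realType) (f F : R -> R) (th : 'rV[R]_10)
    (r : 'rV[R]_4) : 'rV[R]_4 :=
  mk4 (killing_x f th (r 0 ix) (r 0 iy) (r 0 iu) (r 0 iv))
      (killing_y f th (r 0 ix) (r 0 iy) (r 0 iu) (r 0 iv))
      (killing_u f F th (r 0 ix) (r 0 iy) (r 0 iu) (r 0 iv))
      (killing_v f th (r 0 ix) (r 0 iy) (r 0 iu) (r 0 iv)).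

(** The integrability conditions of the Killing system: [b f'] is constant, and [source] is affine
    in [y]. *)
Definition compatible (R : realType) (f : R -> R) (th : 'rV[R]_10) : Prop :=
  (forall y, param th 1 * derive1 f y = param th 1 * derive1 f 0) /\
  (forall x y, source f th x y = source f th x 0 - y * (source f th x 0 - source f th x 1)).

Ltac elem := repeat first
  [ exact: elementary_cst | exact: elementary_coord
  | apply: elementary_opp | apply: elementary_add | apply: elementary_mul
  | apply: elementary_comp; assumption ].

Lemma killing_field_smooth (R : realType) (f F : R -> R) (th : 'rV[R]_10) :
  smooth1 f -> smooth1 F -> smooth_vector_field (killing_field f F th).
Proof.
move=> fs Fs i; apply: elementary_smooth; move: i; apply: forall_I4.
- rewrite (_ : (fun p => _) = fun r : 'rV[R]_4 =>
    killing_x f th (r 0 ix) (r 0 iy) (r 0 iu) (r 0 iv)).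
    by rewrite /killing_x; elem.
  by apply/funext => r; rewrite mxE.
- rewrite (_ : (fun p => _) = fun r : 'rV[R]_4 =>
    killing_y f th (r 0 ix) (r 0 iy) (r 0 iu) (r 0 iv)).
    by rewrite /killing_y; elem.
  by apply/funext => r; rewrite mxE.
- rewrite (_ : (fun p => _) = fun r : 'rV[R]_4 =>
    killing_u f F th (r 0 ix) (r 0 iy) (r 0 iu) (r 0 iv)).
    by rewrite /killing_u /shear; elem.
  by apply/funext => r; rewrite mxE.
- rewrite (_ : (fun p => _) = fun r : 'rV[R]_4 =>
    killing_v f th (r 0 ix) (r 0 iy) (r 0 iu) (r 0 iv)).
    by rewrite /killing_v; elem.
  by apply/funext => r; rewrite mxE.
Qed.

Record has_grad (R : realType) (h hx hy hu hv : R -> R -> R -> R -> R) : Prop :=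
  HasGrad {
    grad_x : forall x y u v, is_derive x (1 : R) (fun t => h t y u v) (hx x y u v);
    grad_y : forall x y u v, is_derive y (1 : R) (fun t => h x t u v) (hy x y u v);
    grad_u : forall x y u v, is_derive u (1 : R) (fun t => h x y t v) (hu x y u v);
    grad_v : forall x y u v, is_derive v (1 : R) (fun t => h x y u t) (hv x y u v) }.

Lemma partial_has_grad (R : realType) (H : 'rV[R]_4 -> R)
    (h hx hy hu hv : R -> R -> R -> R -> R) : has_grad h hx hy hu hv ->
  (forall p, H p = h (p 0 ix) (p 0 iy) (p 0 iu) (p 0 iv)) ->
  forall p k, partial k H p = mk4 (hx (p 0 ix) (p 0 iy) (p 0 iu) (p 0 iv))
    (hy (p 0 ix) (p 0 iy) (p 0 iu) (p 0 iv)) (hu (p 0 ix) (p 0 iy) (p 0 iu) (p 0 iv))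
    (hv (p 0 ix) (p 0 iy) (p 0 iu) (p 0 iv)) 0 k.
Proof.
move=> [gx gy gu gv] HE p; apply: forall_I4; rewrite mxE /=;
  apply/partial_is_derive/is_derive_coord.
- apply: is_derive_eq_fun (gx _ _ _ _) => t; by rewrite HE /set_coord !mxE.
- apply: is_derive_eq_fun (gy _ _ _ _) => t; by rewrite HE /set_coord !mxE.
- apply: is_derive_eq_fun (gu _ _ _ _) => t; by rewrite HE /set_coord !mxE.
- apply: is_derive_eq_fun (gv _ _ _ _) => t; by rewrite HE /set_coord !mxE.
Qed.

Lemma killing_x_grad (R : realType) (f : R -> R) (th : 'rV[R]_10) :
  has_grad (killing_x f th)
    (fun x y u v => param th 1 * derive1 f 0 * x + param th 3)
    (fun x y u v => param th 0) (fun x y u v => 0) (fun x y u v => param th 1).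
Proof. by rewrite /killing_x; split=> x y u v; deriv; field. Qed.

Lemma killing_y_grad (R : realType) (f : R -> R) (th : 'rV[R]_10) :
  has_grad (killing_y f th)
    (fun x y u v => param th 1 * derive1 f 0 * y + param th 5)
    (fun x y u v => param th 2 + param th 1 * derive1 f 0 * x)
    (fun x y u v => - param th 1) (fun x y u v => 0).
Proof. by rewrite /killing_y; split=> x y u v; deriv; field. Qed.

Lemma killing_u_grad (R : realType) (f F : R -> R) (th : 'rV[R]_10) :
  (forall y, is_derive y (1 : R) f (derive1 f y)) ->
  (forall y, is_derive y (1 : R) F (f y)) ->
  has_grad (killing_u f F th)
    (fun x y u v => source f th x 0 - y * (source f th x 0 - source f th x 1)
       - u * (param th 1 * derive1 f 0))
    (fun x y u v => 2 * param th 0 * f y - shear f th x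
       + v * (2 * derive1 f y * param th 1 - param th 1 * derive1 f 0))
    (fun x y u v => - (param th 3 + param th 1 * derive1 f 0 * x))
    (fun x y u v => 2 * f y * param th 1 - param th 5 - y * (param th 1 * derive1 f 0)).
Proof.
by move=> df dF; rewrite /killing_u /shear /source; split=> x y u v; deriv; field.
Qed.

Lemma killing_v_grad (R : realType) (f : R -> R) (th : 'rV[R]_10) :
  has_grad (killing_v f th)
    (fun x y u v => shear f th x - param th 1 * derive1 f 0 * v)
    (fun x y u v => 0)
    (fun x y u v => - param th 0)
    (fun x y u v => - (param th 2 + param th 1 * derive1 f 0 * x)).
Proof. by rewrite /killing_v /shear; split=> x y u v; deriv; field. Qed.

Lemma killing_field_killing (R : realType) (f F : R -> R) (th : 'rV[R]_10) :
  smooth1 f -> (forall y, is_derive y (1 : R) F (f y)) ->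
  compatible f th -> isometry_algebra f (killing_field f F th).
Proof.
move=> fs dF [bf compat].
have df y := smooth1_is_derive y fs.
split; first exact: killing_field_smooth (smooth1_of_derive dF fs).
move=> p; apply/(lie_derivative_metric0 _ (df _)).
have Ex := partial_has_grad (killing_x_grad f th)
  (fun p => mxE _ _ _ _ : killing_field f F th p 0 ix = _).
have Ey := partial_has_grad (killing_y_grad f th)
  (fun p => mxE _ _ _ _ : killing_field f F th p 0 iy = _).
have Eu := partial_has_grad (killing_u_grad th df dF)
  (fun p => mxE _ _ _ _ : killing_field f F th p 0 iu = _).
have Ev := partial_has_grad (killing_v_grad f th)
  (fun p => mxE _ _ _ _ : killing_field f F th p 0 iv = _).
have By : killing_field f F th p 0 iy =
  killing_y f th (p 0 ix) (p 0 iy) (p 0 iu) (p 0 iv) by rewrite mxE.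
(* [ring] settles all equations except [xx], which takes both clauses of compatibility, and [xy],
   which takes the constancy of [b f']. *)
split; rewrite ?Ex ?Ey ?Eu ?Ev ?By !mxE /=; try ring.
- by rewrite -compat /source /killing_y -(bf (p 0 iy)); ring.
- by rewrite -(bf (p 0 iy)); ring.
Qed.

(** * Completeness of the family *)

Lemma eq_of_derive (R : realType) (g h k : R -> R) :
  (forall x, is_derive x (1 : R) g (k x)) ->
  (forall x, is_derive x (1 : R) h (k x)) -> forall x, g x = g 0 + (h x - h 0).
Proof.
move=> dg dh x.
have : g x - h x = g 0 - h 0.
  apply: (@is_derive_0_is_cst _ (fun x => g x - h x)) => z.
  by have := is_derive_fun_add (dg z) (is_derive_fun_opp (dh z)); rewrite subrr.
by lra.
Qed.

Lemma affine_of_derive (R : realType) (g : R -> R) (c : R) :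
  (forall x, is_derive x (1 : R) g c) -> forall x, g x = g 0 + x * c.
Proof.
move=> dg x; have dh (z : R) : is_derive z (1 : R) (fun x => x * c) c.
  by deriv; ring.
by rewrite (eq_of_derive dg dh) mul0r subr0.
Qed.

Lemma cst_of_derive (R : realType) (g : R -> R) :
  (forall x, is_derive x (1 : R) g 0) -> forall x, g x = g 0.
Proof. by move=> dg x; exact: is_derive_0_is_cst. Qed.

Lemma derive_congr (R : realType) (g h : R -> R) (x d e : R) : g =1 h ->
  is_derive x (1 : R) g d -> is_derive x (1 : R) h e -> d = e.
Proof. by move=> gh /(is_derive_eq_fun gh); exact: is_derive_unique. Qed.

Lemma smooth_has_grad (R : realType) (H : 'rV[R]_4 -> R) : smooth H ->
  has_grad (fun x y u v => H (mk4 x y u v))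
    (fun x y u v => partial ix H (mk4 x y u v))
    (fun x y u v => partial iy H (mk4 x y u v))
    (fun x y u v => partial iu H (mk4 x y u v))
    (fun x y u v => partial iv H (mk4 x y u v)).
Proof.
move=> Hs; split=> x y u v.
- have /is_derive_coord := smooth_derivable ix (mk4 x y u v) Hs.
  rewrite mxE /=; apply: is_derive_eq_fun => t; congr (H _); apply/rowP.
  by apply: forall_I4; rewrite !mxE.
- have /is_derive_coord := smooth_derivable iy (mk4 x y u v) Hs.
  rewrite mxE /=; apply: is_derive_eq_fun => t; congr (H _); apply/rowP.
  by apply: forall_I4; rewrite !mxE.
- have /is_derive_coord := smooth_derivable iu (mk4 x y u v) Hs.
  rewrite mxE /=; apply: is_derive_eq_fun => t; congr (H _); apply/rowP.
  by apply: forall_I4; rewrite !mxE.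
- have /is_derive_coord := smooth_derivable iv (mk4 x y u v) Hs.
  rewrite mxE /=; apply: is_derive_eq_fun => t; congr (H _); apply/rowP.
  by apply: forall_I4; rewrite !mxE.
Qed.

(* The hypotheses are the six Killing equations free of [f]. *)
Lemma killing_fibre (R : realType)
    (A Ax Ay Au Av B Bx By Bu Bv D Dx Dy Du Dv : R -> R -> R -> R -> R) :
  has_grad A Ax Ay Au Av -> has_grad B Bx By Bu Bv -> has_grad D Dx Dy Du Dv ->
  (forall x y u v, Au x y u v = 0) -> (forall x y u v, Bv x y u v = 0) ->
  (forall x y u v, Dy x y u v = 0) ->
  (forall x y u v, Ay x y u v + Du x y u v = 0) ->
  (forall x y u v, By x y u v + Dv x y u v = 0) ->
  (forall x y u v, Av x y u v + Bu x y u v = 0) ->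
  forall x y u v,
  [/\ A x y u v = y * (A x 1 0 0 - A x 0 0 0) + A x 0 0 0
        + v * (A x 0 0 1 - A x 0 0 0),
      B x y u v = B x 0 0 0 - u * (A x 0 0 1 - A x 0 0 0)
        + y * (B x 1 0 0 - B x 0 0 0) &
      D x y u v = D x 0 0 0 - u * (A x 1 0 0 - A x 0 0 0)
        - v * (B x 1 0 0 - B x 0 0 0)].
Proof.
move=> [_ dAy dAu dAv] [_ dBy dBu dBv] [_ dDy dDu dDv] Au0 Bv0 Dy0 AyDu ByDv AvBu x.
have EA y u v : A x y u v = A x y 0 v.
  by apply: (@cst_of_derive _ (fun t => A x y t v)) => t; rewrite -(Au0 x y t v).
have EB y u v : B x y u v = B x y u 0.
  by apply: (@cst_of_derive _ (fun t => B x y u t)) => t; rewrite -(Bv0 x y u t).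
have ED y u v : D x y u v = D x 0 u v.
  by apply: (@cst_of_derive _ (fun t => D x t u v)) => t; rewrite -(Dy0 x t u v).
have EAy y u v : Ay x y u v = Ay x y 0 v.
  exact: derive_congr (fun t => EA t u v) (dAy x y u v) (dAy x y 0 v).
have EAv y u v : Av x y u v = Av x y 0 v.
  exact: derive_congr (fun t => EA y u t) (dAv x y u v) (dAv x y 0 v).
have EBy y u v : By x y u v = By x y u 0.
  exact: derive_congr (fun t => EB t u v) (dBy x y u v) (dBy x y u 0).
have EBu y u v : Bu x y u v = Bu x y u 0.
  exact: derive_congr (fun t => EB y t v) (dBu x y u v) (dBu x y u 0).
have EDu y u v : Du x y u v = Du x 0 u v.
  exact: derive_congr (fun t => ED y t v) (dDu x y u v) (dDu x 0 u v).
have EDv y u v : Dv x y u v = Dv x 0 u v.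
  exact: derive_congr (fun t => ED y u t) (dDv x y u v) (dDv x 0 u v).
(* [Ay = - Du] depends on [v] alone, since [A] is free of [u] and [D] of [y]. Likewise [By = - Dv]
   depends on [u] alone, and [Av = - Bu] on [y] alone. *)
pose a v := Ay x 0 0 v; pose b u := By x 0 u 0; pose c y := Av x y 0 0.
have Aya y u v : Ay x y u v = a v.
  rewrite EAy /a; have := AyDu x y 0 v; have := AyDu x 0 0 v; rewrite (EDu y); lra.
have Dua y u v : Du x y u v = - a v.
  by have := AyDu x y u v; rewrite Aya; lra.
have Dvb y u v : Dv x y u v = - b u.
  by rewrite EDv /b; have := ByDv x 0 u v; rewrite EBy; lra.
have Byb y u v : By x y u v = b u.
  by have := ByDv x y u v; rewrite Dvb; lra.
have Buc y u v : Bu x y u v = - c y.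
  have := AvBu x y u 0; have := AvBu x y u v; rewrite (EAv _ _ 0) (EBu _ _ v) /c; lra.
have Avc y u v : Av x y u v = c y.
  by have := AvBu x y u v; rewrite Buc; lra.
have A1 y v : A x y 0 v = A x 0 0 v + y * a v.
  by apply: (@affine_of_derive _ (fun t => A x t 0 v)) => t; rewrite -(Aya t 0).
have A2 y v : A x y 0 v = A x y 0 0 + v * c y.
  by apply: (@affine_of_derive _ (fun t => A x y 0 t)) => t; rewrite -(Avc y 0 t).
have D1 u v : D x 0 u v = D x 0 0 v + u * - a v.
  by apply: (@affine_of_derive _ (fun t => D x 0 t v)) => t; rewrite -(Dua 0 t).
have D2 u v : D x 0 u v = D x 0 u 0 + v * - b u.
  by apply: (@affine_of_derive _ (fun t => D x 0 u t)) => t; rewrite -(Dvb 0 u t).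
have B1 y u : B x y u 0 = B x 0 u 0 + y * b u.
  by apply: (@affine_of_derive _ (fun t => B x t u 0)) => t; rewrite -(Byb t u 0).
have B2 y u : B x y u 0 = B x y 0 0 + u * - c y.
  by apply: (@affine_of_derive _ (fun t => B x y t 0)) => t; rewrite -(Buc y t 0).
clearbody a b c.
(* Expanding [A], [D] and [B] in their two variables in either order gives three identities. At (1,
   1) the increments of [a], [b], [c] from 0 to 1 satisfy da = dc, da = db and dc = - db, so all
   vanish. *)
have AA y v : v * c 0 + y * a v = y * a 0 + v * c y.
  by have := A1 y v; rewrite A2 (A1 y 0) (A2 0 v); lra.
have DD u v : v * b 0 + u * a v = u * a 0 + v * b u.
  by have := D1 u v; rewrite D2 (D1 u 0) (D2 0 v); lra.
have BB y u : u * c 0 - y * b u = u * c y - y * b 0.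
  by have := B1 y u; rewrite B2 (B1 y 0) (B2 0 u); lra.
have a1 : a 1 = a 0 by have := AA 1 1; have := DD 1 1; have := BB 1 1; lra.
have b1 : b 1 = b 0 by have := DD 1 1; lra.
have c1 : c 1 = c 0 by have := AA 1 1; lra.
have a0 v : a v = a 0 by have := AA 1 v; rewrite c1; lra.
have b0 u : b u = b 0 by have := BB 1 u; rewrite c1; lra.
have c0 y : c y = c 0 by have := AA y 1; rewrite a1; lra.
have aE : A x 1 0 0 - A x 0 0 0 = a 0 by rewrite A1; ring.
have bE : B x 1 0 0 - B x 0 0 0 = b 0 by rewrite B1; ring.
have cE : A x 0 0 1 - A x 0 0 0 = c 0 by rewrite A2; ring.
move=> y u v; rewrite aE bE cE; split.
- by rewrite EA A1 A2 a0; ring.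
- by rewrite EB B1 B2 b0; ring.
- by rewrite ED D1 D2 a0; ring.
Qed.

Lemma source_affine (R : realType) (f : R -> R) (th : 'rV[R]_10) (x y : R) :
  source f th x y = source f th 0 y + x * (source f th 1 y - source f th 0 y).
Proof. by rewrite /source; ring. Qed.

Lemma killing_field_complete (R : realType) (f F : R -> R)
    (X : 'rV[R]_4 -> 'rV[R]_4) :
  smooth1 f -> (forall y, is_derive y (1 : R) F (f y)) -> F 0 = 0 ->
  isometry_algebra f X ->
  exists th, compatible f th /\ X = killing_field f F th.
Proof.
move=> fs dF F0 [Xs XK].
have df y := smooth1_is_derive y fs.
pose f1 := derive1 f.
pose D k i x y u v := partial k (fun q => X q 0 i) (mk4 x y u v).
pose A x y u v : R := X (mk4 x y u v) 0 ix; pose B x y u v : R := X (mk4 x y u v) 0 iy.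
pose C x y u v : R := X (mk4 x y u v) 0 iu; pose E x y u v : R := X (mk4 x y u v) 0 iv.
have gA : has_grad A (D ix ix) (D iy ix) (D iu ix) (D iv ix).
  exact: smooth_has_grad.
have gB : has_grad B (D ix iy) (D iy iy) (D iu iy) (D iv iy).
  exact: smooth_has_grad.
have gC : has_grad C (D ix iu) (D iy iu) (D iu iu) (D iv iu).
  exact: smooth_has_grad.
have gE : has_grad E (D ix iv) (D iy iv) (D iu iv) (D iv iv).
  exact: smooth_has_grad.
have K x y u v : killing_eqs (f y) (f1 y) (B x y u v) (fun k i => D k i x y u v).
  have := XK (mk4 x y u v).
  have yE : mk4 x y u v 0 iy = y by rewrite mxE.
  by move=> /(lie_derivative_metric0 _ (df _)); rewrite yE.
have XE r : X r = mk4 (A (r 0 ix) (r 0 iy) (r 0 iu) (r 0 iv))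
    (B (r 0 ix) (r 0 iy) (r 0 iu) (r 0 iv)) (C (r 0 ix) (r 0 iy) (r 0 iu) (r 0 iv))
    (E (r 0 ix) (r 0 iy) (r 0 iu) (r 0 iv)).
  by rewrite /A /B /C /E -(mk4E r); apply/rowP; apply: forall_I4; rewrite mxE.
clearbody A B C E D; clear XK Xs.
have Au0 x y u v : D iu ix x y u v = 0 by case: (K x y u v).
have Bv0 x y u v : D iv iy x y u v = 0 by case: (K x y u v).
have fibre := killing_fibre gA gB gE Au0 Bv0
  (fun x y u v => killing_yy (K x y u v)) (fun x y u v => killing_yu (K x y u v))
  (fun x y u v => killing_yv (K x y u v)) (fun x y u v => killing_uv (K x y u v)).
(* The coefficients found on the fibres, as functions of [x]. The primed ones are built from
   [x]-partials at the same points, hence are their derivatives. *)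
pose al x : R := A x 1 0 0 - A x 0 0 0; pose be x : R := A x 0 0 0.
pose bv x : R := A x 0 0 1 - A x 0 0 0; pose ga x : R := B x 0 0 0.
pose ep x : R := B x 1 0 0 - B x 0 0 0; pose de x : R := E x 0 0 0.
pose al' x : R := D ix ix x 1 0 0 - D ix ix x 0 0 0; pose be' x : R := D ix ix x 0 0 0.
pose bv' x : R := D ix ix x 0 0 1 - D ix ix x 0 0 0; pose ga' x : R := D ix iy x 0 0 0.
pose ep' x : R := D ix iy x 1 0 0 - D ix iy x 0 0 0; pose de' x : R := D ix iv x 0 0 0.
have dal x : is_derive x (1 : R) al (al' x).
  exact: is_derive_fun_add (grad_x gA _ _ _ _) (is_derive_fun_opp (grad_x gA _ _ _ _)).
have dbe x : is_derive x (1 : R) be (be' x) by exact: grad_x gA _ _ _ _.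
have dbv x : is_derive x (1 : R) bv (bv' x).
  exact: is_derive_fun_add (grad_x gA _ _ _ _) (is_derive_fun_opp (grad_x gA _ _ _ _)).
have dga x : is_derive x (1 : R) ga (ga' x) by exact: grad_x gB _ _ _ _.
have dep x : is_derive x (1 : R) ep (ep' x).
  exact: is_derive_fun_add (grad_x gB _ _ _ _) (is_derive_fun_opp (grad_x gB _ _ _ _)).
have dde x : is_derive x (1 : R) de (de' x) by exact: grad_x gE _ _ _ _.
have AE x y u v : A x y u v = y * al x + be x + v * bv x by case: (fibre x y u v).
have BE x y u v : B x y u v = ga x - u * bv x + y * ep x by case: (fibre x y u v).
have EE x y u v : E x y u v = de x - u * al x - v * ep x by case: (fibre x y u v).
clearbody al be bv ga ep de al' be' bv' ga' ep' de'; clear fibre.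
have Ax x y u v : D ix ix x y u v = y * al' x + be' x + v * bv' x.
  notypeclasses refine (derive_congr (fun t => AE t y u v) (grad_x gA x y u v) _).
  by deriv; ring.
have Ay x y u v : D iy ix x y u v = al x.
  notypeclasses refine (derive_congr (fun t => AE x t u v) (grad_y gA x y u v) _).
  by deriv; ring.
have Av x y u v : D iv ix x y u v = bv x.
  notypeclasses refine (derive_congr (fun t => AE x y u t) (grad_v gA x y u v) _).
  by deriv; ring.
have Bx x y u v : D ix iy x y u v = ga' x - u * bv' x + y * ep' x.
  notypeclasses refine (derive_congr (fun t => BE t y u v) (grad_x gB x y u v) _).
  by deriv; ring.
have Ex x y u v : D ix iv x y u v = de' x - u * al' x - v * ep' x.
  notypeclasses refine (derive_congr (fun t => EE t y u v) (grad_x gE x y u v) _).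
  by deriv; ring.
have Cx x y u v : D ix iu x y u v = f1 y * (ga x - u * bv x + y * ep x)
    + 2 * f y * (y * al' x + be' x + v * bv' x).
  by rewrite (killing_xx (K x y u v)) BE Ax.
have Cy x y u v : D iy iu x y u v = 2 * f y * al x - (de' x - u * al' x - v * ep' x).
  by have := killing_xy (K x y u v); rewrite Ay Ex; lra.
have Cu x y u v : D iu iu x y u v = - (y * al' x + be' x + v * bv' x).
  by have := killing_xu (K x y u v); rewrite Au0 Ax; lra.
have Cv x y u v : D iv iu x y u v = 2 * f y * bv x - (ga' x - u * bv' x + y * ep' x).
  by have := killing_xv (K x y u v); rewrite Av Bx; lra.
clear K Au0 Bv0 gA gB gE Ax Ay Av Bx Ex.
have C1 x y u v : C x y u v = C x y 0 v + u * - (y * al' x + be' x + v * bv' x).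
  apply: (@affine_of_derive _ (fun t => C x y t v)) => t.
  by rewrite -(Cu x y t v); exact: grad_u gC _ _ _ _.
have C2 x y u v : C x y u v = C x y u 0
    + v * (2 * f y * bv x - (ga' x - u * bv' x + y * ep' x)).
  apply: (@affine_of_derive _ (fun t => C x y u t)) => t.
  by rewrite -(Cv x y u t); exact: grad_v gC _ _ _ _.
(* The coefficient of [u v] in [C] is [- bv'] by [C1] and [bv'] by [C2]. *)
have bv'0 x : bv' x = 0.
  have h1 := C1 x 0 1 1; have h2 := C2 x 0 0 1; have h3 := C2 x 0 1 1.
  have h4 := C1 x 0 1 0; move: h1 h2 h3 h4.
  move: (f 0 * bv x) => ?; lra.
have CE x y u v : C x y u v = C x y 0 0 + v * (2 * f y * bv x - ga' x - y * ep' x)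
    - u * (y * al' x + be' x).
  by rewrite C1 C2 bv'0; ring.
have dC x y : is_derive y (1 : R) (fun t => C x t 0 0) (D iy iu x y 0 0).
  exact: grad_y gC _ _ _ _.
(* Differentiating [CE] in [y] and comparing with [Cy] gives [al' = - al'] at [u = 1], and
   [ep' = 2 f' bv - ep'] at [v = 1]. *)
have al'0 x : al' x = 0.
  have dR : is_derive (0 : R) (1 : R) (fun t => C x t 0 0
      + 0 * (2 * f t * bv x - ga' x - t * ep' x) - 1 * (t * al' x + be' x))
      (D iy iu x 0 0 0 - al' x).
    by have dCx := dC x; deriv; ring.
  have := derive_congr (fun t => CE x t 1 0) (grad_y gC x 0 1 0) dR.
  by rewrite !Cy; lra.
have ep'E x y : ep' x = f1 y * bv x.
  have dR : is_derive y (1 : R) (fun t => C x t 0 0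
      + 1 * (2 * f t * bv x - ga' x - t * ep' x) - 0 * (t * al' x + be' x))
      (D iy iu x y 0 0 + 2 * f1 y * bv x - ep' x).
    by have dCx := dC x; rewrite /f1; deriv; ring.
  have := derive_congr (fun t => CE x t 0 1) (grad_y gC x y 0 1) dR.
  by rewrite !Cy; lra.
have alE x : al x = al 0.
  by apply: cst_of_derive => z; rewrite -(al'0 z).
have bvE x : bv x = bv 0.
  by apply: cst_of_derive => z; rewrite -(bv'0 z).
have epE x : ep x = ep 0 + x * (f1 0 * bv 0).
  by apply: affine_of_derive => z; rewrite -(bvE z) -ep'E.
(* [be'] is minus a [u]-slope of [C], thus a difference of values of [C], which makes it
   differentiable with derivative given by [Cx]. The same device serves [ga'] and [de']. *)
have be'E x : be' x = be' 0 + x * (f1 0 * bv 0).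
  apply: affine_of_derive => z.
  apply: (@is_derive_eq_fun _ (fun t => C t 0 0 0 - C t 0 1 0)) => [t|].
    by rewrite (CE t 0 1 0); ring.
  have := is_derive_fun_add (grad_x gC z 0 0 0) (is_derive_fun_opp (grad_x gC z 0 1 0)).
  by rewrite !Cx; move=> dd; notypeclasses refine (is_derive_eq dd _); rewrite -(bvE z); ring.
have ga'E x : ga' x = ga' 0.
  apply: cst_of_derive => z.
  apply: (@is_derive_eq_fun _ (fun t => 2 * f 0 * bv 0 + (C t 0 0 0 - C t 0 0 1))) => [t|].
    by rewrite (CE t 0 0 1) (bvE t); ring.
  have := is_derive_fun_add (is_derive_fun_cst (2 * f 0 * bv 0) z)
    (is_derive_fun_add (grad_x gC z 0 0 0) (is_derive_fun_opp (grad_x gC z 0 0 1))).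
  by rewrite !Cx; move=> dd; notypeclasses refine (is_derive_eq dd _); rewrite bv'0; ring.
have gaE x : ga x = ga 0 + x * ga' 0.
  by apply: affine_of_derive => z; rewrite -(ga'E z).
have beE x : be x = be 0 + (be' 0 * x + f1 0 * bv 0 * (x * x / 2)).
  have dh z : is_derive z (1 : R)
      (fun x => be' 0 * x + f1 0 * bv 0 * (x * x / 2)) (be' z).
    by rewrite (be'E z); deriv; field.
  by rewrite (eq_of_derive dbe dh); ring.
pose th : 'rV[R]_10 := params 9 [:: al 0; bv 0; ep 0; be' 0; be 0;
  ga' 0; ga 0; de 0; de' 0; C 0 0 0 0].
have srcE x y : D ix iu x y 0 0 = source f th x y.
  rewrite Cx al'0 bv'0 be'E gaE epE /source /th !param_row//= -/f1; ring.
have Cy0 x y : C x y 0 0 = C x 0 0 0 + (2 * al 0 * F y - y * de' x).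
  have dCx z : is_derive z (1 : R) (fun t => C x t 0 0) (2 * f z * al 0 - de' x).
    have := grad_y gC x z 0 0; rewrite Cy al'0 alE.
    by move=> dd; notypeclasses refine (is_derive_eq dd _); ring.
  have dh z : is_derive z (1 : R) (fun y => 2 * al 0 * F y - y * de' x)
      (2 * f z * al 0 - de' x).
    by deriv; ring.
  by rewrite (eq_of_derive dCx dh) F0; ring.
have dCs x y : is_derive x (1 : R) (fun t => C t y 0 0) (source f th x y).
  by rewrite -srcE; exact: grad_x gC _ _ _ _.
have cE x : C x 0 0 0 = param th 9 + x * source f th 0 0
    + x * x / 2 * (source f th 1 0 - source f th 0 0).
  have dh z : is_derive z (1 : R) (fun x => x * source f th 0 0
      + x * x / 2 * (source f th 1 0 - source f th 0 0)) (source f th z 0).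
    by rewrite (source_affine _ _ z); deriv; field.
  rewrite (eq_of_derive (dCs ^~ 0) dh) {3}/th param_row//=; ring.
have dde' x : is_derive x (1 : R) de' (source f th x 0 - source f th x 1).
  apply: (@is_derive_eq_fun _ (fun t => C t 0 0 0 + (2 * al 0 * F 1 - C t 1 0 0))).
    by move=> t; rewrite (Cy0 t 1); ring.
  have := is_derive_fun_add (dCs x 0)
    (is_derive_fun_add (is_derive_fun_cst (2 * al 0 * F 1) x) (is_derive_fun_opp (dCs x 1))).
  by move=> dd; notypeclasses refine (is_derive_eq dd _); ring.
have de'E x : de' x = shear f th x.
  have dh z : is_derive z (1 : R) (shear f th) (source f th z 0 - source f th z 1).
    by rewrite (source_affine _ _ z 0) (source_affine _ _ z 1) /shear; deriv; field.
  rewrite (eq_of_derive dde' dh) /shear {2}/th param_row//=; ring.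
have deE x : de x = param th 7 + param th 8 * x + x * x / 2 * (source f th 0 0 - source f th 0 1)
  + x * x * x / 6 * (source f th 1 0 - source f th 1 1 - (source f th 0 0 - source f th 0 1)).
  have dh z : is_derive z (1 : R) (fun x => param th 8 * x
      + x * x / 2 * (source f th 0 0 - source f th 0 1)
      + x * x * x / 6 * (source f th 1 0 - source f th 1 1 - (source f th 0 0 - source f th 0 1)))
      (de' z).
    by rewrite (de'E z) /shear; deriv; field.
  rewrite (eq_of_derive dde dh) [param th 7]param_row//=; ring.
exists th; split; first split=> [y|x y].
- by rewrite param_row//= mulrC -(ep'E 0 y) (ep'E 0 0) mulrC.
(* Comparing [C] at heights 0 and [y] differentiates [y * de']; the result must be [y] times the one
   for height 1, which is affinity of [source] in [y]. *)
- have dy : is_derive x (1 : R) (fun t => y * de' t) (source f th x 0 - source f th x y).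
    apply: (@is_derive_eq_fun _ (fun t => C t 0 0 0 + (2 * al 0 * F y - C t y 0 0))).
      by move=> t; rewrite (Cy0 t y); ring.
    have := is_derive_fun_add (dCs x 0)
      (is_derive_fun_add (is_derive_fun_cst (2 * al 0 * F y) x) (is_derive_fun_opp (dCs x y))).
    by move=> dd; notypeclasses refine (is_derive_eq dd _); ring.
  have := is_derive_unique dy (is_derive_fun_mul (is_derive_fun_cst y x) (dde' x)); lra.
apply/funext => r; rewrite XE /killing_field; congr mk4.
- rewrite AE alE beE bvE /killing_x /th !param_row//= -/f1; ring.
- rewrite BE gaE epE bvE /killing_y /th !param_row//= -/f1; ring.
- rewrite CE Cy0 cE de'E (ga'E (r 0 ix)) (ep'E _ 0) al'0 (be'E (r 0 ix)).
  rewrite (bvE (r 0 ix)) /killing_u.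
  rewrite [param th 0]param_row// [param th 1]param_row// [param th 3]param_row//.
  rewrite [param th 5]param_row//= -/f1; ring.
- rewrite EE deE alE epE /killing_v.
  rewrite [param th 0]param_row// [param th 1]param_row// [param th 2]param_row//= -/f1; ring.
Qed.

(** * Dimension count *)

Lemma has_dim_image (R : realType) (V : lmodType R) (K : set V) (d : nat)
    (Psi : 'rV[R]_d -> V) :
  (forall k u w, Psi (k *: u + w) = k *: Psi u + Psi w) ->
  (forall u, Psi u = 0 -> u = 0) ->
  K = [set Psi u | u in [set: 'rV[R]_d]] -> has_dim K d.
Proof.
move=> lin inj KE.
have Psi0 : Psi 0 = 0.
  by have := lin (-1) 0 0; rewrite scaler0 addr0 scaleN1r addNr.
have sumE (c : 'I_d -> R) :
    \sum_i c i *: Psi (delta_mx 0 i) = Psi (\row_i c i).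
  rewrite [X in Psi X]row_sum_delta.
  under [in RHS]eq_bigr do rewrite mxE.
  elim: (index_enum _) => [|i s IH]; first by rewrite !big_nil Psi0.
  by rewrite !big_cons lin IH.
exists (fun i => Psi (delta_mx 0 i)); split=> [c|].
  by rewrite sumE => /inj /rowP c0 i; have := c0 i; rewrite !mxE.
rewrite KE; apply/seteqP; split=> [_ [u _ <-]|_ [c ->]] /=.
  exists (fun i => u 0 i); rewrite sumE; congr Psi.
  by apply/rowP => i; rewrite mxE.
by exists (\row_i c i); rewrite ?sumE.
Qed.

Lemma param_inj (R : realType) (n : nat) (t w : 'rV[R]_n.+1) :
  (forall k, (k < n.+1)%N -> param t k = param w k) -> t = w.
Proof.
by move=> E; apply/rowP => i; have := E i (ltn_ord i); rewrite /param inord_val.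
Qed.

Lemma param_lin (R : realType) (n : nat) (c : R) (t w : 'rV[R]_n.+1) k :
  param (c *: t + w) k = c * param t k + param w k.
Proof. by rewrite /param !mxE. Qed.

Lemma param0 (R : realType) (n : nat) k : param (0 : 'rV[R]_n.+1) k = 0.
Proof. by rewrite /param mxE. Qed.

Lemma killing_field_lin (R : realType) (f F : R -> R) (c : R) (t w : 'rV[R]_10) :
  killing_field f F (c *: t + w) = c *: killing_field f F t + killing_field f F w.
Proof.
apply/funext => r; apply/rowP; apply: forall_I4; rewrite !mxE /=.
- by rewrite /killing_x !param_lin; ring.
- by rewrite /killing_y !param_lin; ring.
- by rewrite /killing_u /shear /source !param_lin; field.
- by rewrite /killing_v /source !param_lin; field.
Qed.

(** Each parameter is read off at the origin or at a point with one coordinate 1 and the others 0.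
    The normalisation of [F] makes the [u]-component at the origin equal to c0. *)
Lemma killing_field_inj (R : realType) (f F : R -> R) (th : 'rV[R]_10) :
  F 0 = 0 -> killing_field f F th = 0 -> th = 0.
Proof.
move=> F0 th0.
have E x y u v i : killing_field f F th (mk4 x y u v) 0 i = 0 by rewrite th0 mxE.
have p4 : param th 4 = 0 by have := E 0 0 0 0 ix; rewrite !mxE /= /killing_x; lra.
have p0 : param th 0 = 0 by have := E 0 1 0 0 ix; rewrite !mxE /= /killing_x; lra.
have p1 : param th 1 = 0 by have := E 0 0 0 1 ix; rewrite !mxE /= /killing_x; lra.
have p3 : param th 3 = 0.
  by have := E 1 0 0 0 ix; rewrite !mxE /= /killing_x p1; lra.
have p6 : param th 6 = 0 by have := E 0 0 0 0 iy; rewrite !mxE /= /killing_y; lra.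
have p5 : param th 5 = 0.
  by have := E 1 0 0 0 iy; rewrite !mxE /= /killing_y p1; lra.
have p2 : param th 2 = 0.
  by have := E 0 1 0 0 iy; rewrite !mxE /= /killing_y p1; lra.
have s0 x y : source f th x y = 0 by rewrite /source p1 p2 p3 p5 p6; ring.
have p7 : param th 7 = 0.
  by have := E 0 0 0 0 iv; rewrite !mxE /= /killing_v !s0; lra.
have p8 : param th 8 = 0.
  by have := E 1 0 0 0 iv; rewrite !mxE /= /killing_v !s0 p7; lra.
have p9 : param th 9 = 0.
  by have := E 0 0 0 0 iu; rewrite !mxE /= /killing_u !s0 F0; lra.
by apply: param_inj; do 10 (case=> [_|]; first by rewrite param0).
Qed.

(** The first clause is differentiated once in [y] and the second twice. The latter result is affine
    in [x] modulo the first condition, and its two coefficients are the other conditions.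
    Conversely, both clauses follow by integration. *)
Lemma compatibleE (R : realType) (f : R -> R) (th : 'rV[R]_10) : smooth1 f ->
  compatible f th <-> forall y,
    [/\ param th 1 * derive1 (derive1 f) y = 0,
        param th 5 * derive1 (derive1 (derive1 f)) y = 0 &
        derive1 (derive1 (derive1 f)) y * (param th 2 * y + param th 6)
        + 2 * (param th 2 + param th 3) * derive1 (derive1 f) y = 0].
Proof.
move=> fs.
have df y := smooth1_is_derive y fs.
have df1 y := smooth1_is_derive y (smooth1_derive fs).
have df2 y := smooth1_is_derive y (smooth1_derive (smooth1_derive fs)).
set f1 := derive1 f in df df1 df2 *; set f2 := derive1 f1 in df1 df2 *.
set f3 := derive1 f2 in df2 *.
clearbody f3; clearbody f2.
pose e x := param th 2 + param th 1 * f1 0 * x.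
pose q x := param th 5 * x + param th 6.
pose s x := param th 3 + param th 1 * f1 0 * x.
have dsrc x y : is_derive y (1 : R) (source f th x)
    (f2 y * (e x * y + q x) + f1 y * (e x + 2 * s x)).
  by rewrite /source -/f1 -/(e x) -/(s x) /e /q /s; deriv; ring.
have ddsrc x y : is_derive y (1 : R)
    (fun y => f2 y * (e x * y + q x) + f1 y * (e x + 2 * s x))
    (f3 y * (e x * y + q x) + 2 * (e x + s x) * f2 y).
  by deriv; ring.
split=> [[bf compat] y|L].
  have b2 z : param th 1 * f2 z = 0.
    have dl : is_derive z (1 : R) (fun z => param th 1 * f1 z) (param th 1 * f2 z).
      by deriv; ring.
    exact: derive_congr bf dl (is_derive_fun_cst _ z).
  have b3 : param th 1 * f3 y = 0.
    have dl : is_derive y (1 : R) (fun z => param th 1 * f2 z) (param th 1 * f3 y).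
      by deriv; ring.
    exact: derive_congr b2 dl (is_derive_fun_cst _ y).
  have main x : f3 y * (e x * y + q x) + 2 * (e x + s x) * f2 y = 0.
    have dk z : f2 z * (e x * z + q x) + f1 z * (e x + 2 * s x) =
        - (source f th x 0 - source f th x 1).
      apply: derive_congr (compat x) (dsrc x z) _.
      by deriv; ring.
    exact: derive_congr dk (ddsrc x y) (is_derive_fun_cst _ y).
  split; [exact: b2| |by rewrite -[RHS](main 0) /e /q /s; ring].
  (* The coefficient of [x] is the value at 1 minus the value at 0; the corrections are the terms in
     [b f''] and [b f'''], already known to vanish. *)
  have -> : param th 5 * f3 y = (f3 y * (e 1 * y + q 1) + 2 * (e 1 + s 1) * f2 y)
      - (f3 y * (e 0 * y + q 0) + 2 * (e 0 + s 0) * f2 y)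
      - f1 0 * y * (param th 1 * f3 y) - 4 * f1 0 * (param th 1 * f2 y).
    by rewrite /e /q /s; ring.
  have m0 := main 0; have m1 := main 1; have b2y := b2 y.
  by rewrite m0 m1 b3 b2y; ring.
have b2 y : param th 1 * f2 y = 0 by case: (L y).
have b3 y : param th 1 * f3 y = 0.
  have dl : is_derive y (1 : R) (fun z => param th 1 * f2 z) (param th 1 * f3 y).
    by deriv; ring.
  exact: derive_congr b2 dl (is_derive_fun_cst _ y).
split=> [y|x y].
  apply: (@cst_of_derive _ (fun z => param th 1 * f1 z)) => z.
  by rewrite -(b2 z); deriv; ring.
have dd0 z : is_derive z (1 : R)
    (fun y => f2 y * (e x * y + q x) + f1 y * (e x + 2 * s x)) 0.
  have [_ p3 m] := L z; have b2z := b2 z; have b3z := b3 z.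
  notypeclasses refine (is_derive_eq (ddsrc x z) _).
  transitivity (f3 z * (param th 2 * z + param th 6) + 2 * (param th 2 + param th 3) * f2 z
    + f1 0 * x * z * (param th 1 * f3 z) + 4 * f1 0 * x * (param th 1 * f2 z)
    + x * (param th 5 * f3 z)).
    by rewrite /e /q /s; ring.
  by rewrite m b2z b3z p3; ring.
have H := affine_of_derive2 (dsrc x) dd0 y.
by rewrite H; ring.
Qed.

(** Reduces the dimension to linear algebra in [R^10]: [psi] parametrises the compatible rows
    linearly and [pi] recovers the parameters. *)
Lemma has_dim_isometry_algebra (R : realType) (f : R -> R) (d : nat)
    (psi : 'rV[R]_d -> 'rV[R]_10) (pi : 'rV[R]_10 -> 'rV[R]_d) :
  smooth1 f -> (forall c u w, psi (c *: u + w) = c *: psi u + psi w) ->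
  cancel psi pi -> (forall u, compatible f (psi u)) ->
  (forall th, compatible f th -> psi (pi th) = th) ->
  has_dim (isometry_algebra f) d.
Proof.
move=> fs lin psiK compat surj.
have cf : continuous f.
  by move=> x; apply/differentiable_continuous/derivable1_diffP/(fs 0%N).
have [F [F0 dF]] := continuous_primitive cf.
have psi0 : psi 0 = 0.
  by have := lin (-1) 0 0; rewrite scaler0 addr0 scaleN1r addNr.
apply: (has_dim_image (Psi := fun u => killing_field f F (psi u))).
- by move=> c u w; rewrite lin killing_field_lin.
- move=> u /(killing_field_inj F0) u0.
  by rewrite -(psiK u) u0 -psi0 psiK.
apply/seteqP; split=> [X XK|_ [u _ <-]].
  have [th [thc ->]] := killing_field_complete fs dF F0 XK.
  by exists (pi th) => //=; rewrite surj.
exact: killing_field_killing.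
Qed.

Ltac coords := apply: param_inj;
  do 10 (case=> [|]; [by move=> _; rewrite ?param_lin ?param_row//= ?param_lin; ring | try done]).

(** * The five forms of the second derivative *)

Theorem theorem1p11 (R : realType) (f : R -> R) (f_analytic : real_analytic f) :
  ((forall y : R, f^`(2) y = 0) -> has_dim (isometry_algebra f) 10) /\
  (forall c : R, c != 0 -> (forall y : R, f^`(2) y = c) ->
     has_dim (isometry_algebra f) 8) /\
  (forall a lambda : R, a != 0 -> lambda != 0 ->
     (forall y : R, f^`(2) y = a * expR (lambda * y)) ->
     has_dim (isometry_algebra f) 6) /\
  (forall (a b : R) (n : nat), a != 0 -> (1 <= n)%N ->
     (forall y : R, f^`(2) y = a * (y + b) ^+ n) ->
     has_dim (isometry_algebra f) 6) /\
  (~ (exists a lambda : R, forall y : R, f^`(2) y = a * expR (lambda * y)) ->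
   ~ (exists (a b : R) (n : nat), forall y : R, f^`(2) y = a * (y + b) ^+ n) ->
     has_dim (isometry_algebra f) 5).
Proof.
have fs := real_analytic_smooth1 f_analytic.
have gs := smooth1_derive (smooth1_derive fs).
change (derive1n 2 f) with (derive1 (derive1 f)).
set g := derive1 (derive1 f) in gs *.
have dg y := smooth1_is_derive y gs.
have compE th : compatible f th <-> forall y,
    [/\ param th 1 * g y = 0, param th 5 * derive1 g y = 0 &
        derive1 g y * (param th 2 * y + param th 6)
        + 2 * (param th 2 + param th 3) * g y = 0] := compatibleE th fs.
clearbody g.
have mul0 (x y : R) : x != 0 -> y * x = 0 -> y = 0.
  by move=> x0 /eqP; rewrite mulf_eq0 (negbTE x0) orbF => /eqP.
split; last split; last split; last split.
- move=> g0.
  have g'0 y : derive1 g y = 0.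
    exact: derive_congr g0 (dg y) (is_derive_fun_cst 0 y).
  (* All three conditions are void, so the ten parameters are free. *)
  apply: (has_dim_isometry_algebra (psi := id) (pi := id)) => // th.
  by apply/compE => y; rewrite g0 g'0; split; ring.
- move=> c c0 gc.
  have g'0 y : derive1 g y = 0.
    exact: derive_congr gc (dg y) (is_derive_fun_cst c y).
  (* The conditions amount to [b = 0] and [s = - e], which leaves eight parameters. *)
  apply: (has_dim_isometry_algebra
    (psi := fun u : 'rV[R]_8 => params 9 [:: param u 0; 0; param u 1; - param u 1; param u 2;
       param u 3; param u 4; param u 5; param u 6; param u 7])
    (pi := fun th => params 7 [:: param th 0; param th 2; param th 4; param th 5; param th 6;
       param th 7; param th 8; param th 9])) => //.
  + by move=> k u w; coords.
  + by move=> u; coords.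
  + move=> u; apply/compE => y; rewrite !param_row//= gc g'0.
    by split; ring.
  + move=> th /compE/(_ 0)[]; rewrite gc g'0 => /(mul0 _ _ c0) p1 _ p23.
    have {}p23 : param th 3 = - param th 2.
      have : param th 2 + param th 3 = 0.
        apply: (mul0 (2 * c)); first by rewrite mulf_neq0.
        by rewrite -[RHS]p23; ring.
      by lra.
    apply: param_inj.
    by do 10 (case=> [|]; [move=> _; rewrite !param_row//= ?p1 ?p23|]).
- move=> a l a0 l0 gE.
  have g'E y : derive1 g y = l * g y.
    have de : is_derive y (1 : R) (fun y => a * expR (l * y)) (l * g y).
      have dl : is_derive y (1 : R) (fun y => l * y) l by deriv; ring.
      have := @is_derive1_comp R expR _ y _ _ (is_derive_expR (l * y)) dl.
      move=> /(is_derive_fun_mul (is_derive_fun_cst a y)) dd.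
      by notypeclasses refine (is_derive_eq dd _); rewrite gE/=; ring.
    exact: derive_congr gE (dg y) de.
  have gn0 y : g y != 0 by rewrite gE mulf_neq0// gt_eqF// expR_gt0.
  (* Dividing the third condition by [g] gives [l (e y + q) + 2 (e + s) = 0] for all [y]: hence
     [e = 0] and [s = - l q / 2]. With [b = p = 0], six parameters remain. *)
  apply: (has_dim_isometry_algebra
    (psi := fun u : 'rV[R]_6 => params 9 [:: param u 0; 0; 0; - (l / 2 * param u 1);
       param u 2; 0; param u 1; param u 3; param u 4; param u 5])
    (pi := fun th => params 5 [:: param th 0; param th 6; param th 4; param th 7; param th 8;
       param th 9])) => //.
  + by move=> k u w; coords.
  + by move=> u; coords.
  + move=> u; apply/compE => y; rewrite !param_row//= g'E.
    by split; field.
  + move=> th /compE L.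
    have main y : l * (param th 2 * y + param th 6) + 2 * (param th 2 + param th 3) = 0.
      have [_ _ m] := L y; apply: (mul0 (g y)) => //.
      by rewrite -[RHS]m g'E; ring.
    have p2 : param th 2 = 0.
      by apply: (mul0 l) => //; have := main 0; have := main 1; lra.
    have p3 : param th 3 = - (l / 2 * param th 6) by have := main 0; rewrite p2; lra.
    have [p1 p5 _] := L 0.
    have {}p1 : param th 1 = 0 by apply: mul0 p1.
    have {}p5 : param th 5 = 0 by apply: mul0 p5; rewrite g'E mulf_neq0.
    apply: param_inj.
    by do 10 (case=> [|]; [move=> _; rewrite !param_row//= ?p1 ?p2 ?p3 ?p5|]).
- move=> a b n a0 n1 gE.
  have g'E y : derive1 g y = a * n%:R * (y + b) ^+ n.-1.
    have dy : is_derive y (1 : R) (fun y => y + b) 1 by deriv; ring.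
    have dd := is_derive_fun_mul (is_derive_fun_cst a y) (is_derive_fun_exp n dy).
    have dp : is_derive y (1 : R) (fun y => a * (y + b) ^+ n)
        (a * n%:R * (y + b) ^+ n.-1).
      by notypeclasses refine (is_derive_eq dd _); ring.
    exact: derive_congr gE (dg y) dp.
  have euler y : derive1 g y * (y + b) = n%:R * g y.
    by rewrite g'E gE -{4}(prednK n1) exprSr; ring.
  have g1 : g (1 - b) != 0 by rewrite gE subrK expr1n mulr1.
  have n0 : n%:R != 0 :> R by rewrite pnatr_eq0 -lt0n.
  have g'1 : derive1 g (1 - b) != 0 by rewrite g'E subrK expr1n mulr1 mulf_neq0.
  (* Here [b] is the shift of the power. The parameters [param th 1] and [param th 5] vanish, and
     the Euler equation turns the third condition into [n (e y + q) + 2 (e + s) (y + b) = 0], so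
     [q = b e] and [s = - (1 + n / 2) e]. *)
  apply: (has_dim_isometry_algebra
    (psi := fun u : 'rV[R]_6 => params 9 [:: param u 0; 0; param u 1;
       - ((1 + n%:R / 2) * param u 1); param u 2; 0; b * param u 1; param u 3; param u 4;
       param u 5])
    (pi := fun th => params 5 [:: param th 0; param th 2; param th 4; param th 7; param th 8;
       param th 9])) => //.
  + by move=> k u w; coords.
  + by move=> u; coords.
  + move=> u; apply/compE => y; rewrite !param_row//=; split; [ring|ring|].
    transitivity (param u 1 * (derive1 g y * (y + b) - n%:R * g y)); first by field.
    by rewrite euler; ring.
  + move=> th /compE L.
    have main y : (y + b) != 0 -> n%:R * (param th 2 * y + param th 6)
        + 2 * (param th 2 + param th 3) * (y + b) = 0.
      move=> yb; have [_ _ m] := L y; apply: (mul0 (g y)).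
        by rewrite gE mulf_neq0// expf_neq0.
      transitivity ((derive1 g y * (param th 2 * y + param th 6)
        + 2 * (param th 2 + param th 3) * g y) * (y + b)
        - (param th 2 * y + param th 6) * (derive1 g y * (y + b) - n%:R * g y)).
        by ring.
      by rewrite m euler; ring.
    (* Two points off the zero of [g], with [y + b] equal to 1 and 2, determine the affine
       identity. *)
    have m1 := main (1 - b); have m2 := main (2 - b).
    rewrite !subrK oner_eq0 in m1; rewrite subrK pnatr_eq0 in m2.
    have {}m1 := m1 isT; have {}m2 := m2 isT.
    have p6 : param th 6 = b * param th 2 by apply: (mulfI n0); lra.
    have p3 : param th 3 = - ((1 + n%:R / 2) * param th 2) by rewrite p6 in m1; lra.
    have [p1 p5 _] := L (1 - b).
    have {}p1 : param th 1 = 0 by apply: mul0 p1.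
    have {}p5 : param th 5 = 0 by apply: mul0 p5.
    apply: param_inj.
    by do 10 (case=> [|]; [move=> _; rewrite !param_row//= ?p1 ?p3 ?p5 ?p6|]).
- move=> nexp npow.
  (* Zero and the constants are of the excluded exponential form, with [a = 0] or [lambda = 0]; so
     neither [g] nor its derivative vanishes identically. *)
  have [y0 gy0] : exists y, g y != 0.
    apply: contrapT => g0; apply: nexp; exists 0, 0 => y.
    by rewrite mul0r; apply/eqP/negPn/negP => gy; apply: g0; exists y.
  have [y1 gy1] : exists y, derive1 g y != 0.
    apply: contrapT => g0; apply: nexp; exists (g 0), 0; apply: exp_ode => // y.
    by rewrite mul0r; apply/eqP/negPn/negP => gy; apply: g0; exists y.
  apply: (has_dim_isometry_algebra
    (psi := fun u : 'rV[R]_5 => params 9 [:: param u 0; 0; 0; 0; param u 1; 0; 0;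
       param u 2; param u 3; param u 4])
    (pi := fun th => params 4 [:: param th 0; param th 4; param th 7; param th 8;
       param th 9])) => //.
  + by move=> k u w; coords.
  + by move=> u; coords.
  + by move=> u; apply/compE => y; rewrite !param_row//=; split; ring.
  + move=> th /compE L.
    have p1 : param th 1 = 0 by have [p1 _ _] := L y0; apply: mul0 p1.
    have p5 : param th 5 = 0 by have [_ p5 _] := L y1; apply: mul0 p5.
    (* If [e <> 0], the third condition is the Euler equation with shift [q / e] and exponent
       [- 2 (e + s) / e], and [g] would be an excluded power. *)
    have p2 : param th 2 = 0.
      apply/eqP/negPn/negP => e0; apply: npow.
      have [a [n gE]] : exists (a : R) n, forall y,
          g y = a * (y + param th 6 / param th 2) ^+ n.
        apply: (euler_power (m := - (2 * (param th 2 + param th 3)) / param th 2) gs) => y.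
        have [_ _ m] := L y; apply: (mulfI e0).
        transitivity (derive1 g y * (param th 2 * y + param th 6)); first by field.
        transitivity (- (2 * (param th 2 + param th 3) * g y)); last by field.
        by lra.
      by exists a, (param th 6 / param th 2), n.
    (* With [e = 0] and [q <> 0] the condition reads [g' = - (2 s / q) g], an excluded
       exponential. *)
    have p6 : param th 6 = 0.
      apply/eqP/negPn/negP => q0; apply: nexp.
      exists (g 0), (- (2 * param th 3) / param th 6); apply: exp_ode => // y.
      have [_ _ m] := L y; rewrite p2 in m; apply: (mulfI q0).
      transitivity (- (2 * param th 3 * g y)); last by field.
      by lra.
    have p3 : param th 3 = 0.
      by have [_ _ m] := L y0; apply: (mul0 (g y0)) => //; rewrite p2 p6 in m; lra.
    apply: param_inj.
    by do 10 (case=> [|]; [move=> _; rewrite !param_row//= ?p1 ?p2 ?p3 ?p5 ?p6|]).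
Qed.
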